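(* Let $G$ be a finite connected simple graph. Then the matching polytope $P_M(G)$ is Gorenstein if and only if $G$ is one of the following: (a) a bipartite graph all of whose essential vertices have the same degree; (b) the $5$-cycle $C_5$; (c) a graph all of whose essential vertices have degree $3$ and each of whose blocks is bipartite, $K_3$, $K_4$, $K_{1,1,2}$, or $C'_5$.
   Context: For a graph $G$ with edge set $E$, a matching $m\subseteq E$ is identified with its indicator vector in $\mathbb{R}^E$; the matching polytope $P_M(G)\subset\mathbb{R}^E$ is the convex hull of the indicator vectors of all matchings of $G$. A lattice polytope $P\subset\mathbb{R}^d$ is reflexive if both $P$ and its polar dual $P^*=\{y\in\mathbb{R}^d:\langle x,y\rangle\ge -1 \text{ for all } x\in P\}$ are lattice polytopes; $P$ is Gorenstein if there exist $k\in\mathbb{Z}_{>0}$ and $\alpha\in\mathbb{Z}^d$ such that $kP-\alpha$ is reflexive (equivalently, its Ehrhart ring is Gorenstein). A vertex $u$ of $G$ is essential if (1) $\deg_G(u)=1$ and its neighbor also has degree $1$, or (2) $\deg_G(u)=2$ and its two neighbors are not adjacent, or (3) $\deg_G(u)\ge 3$. A block is a maximal connected subgraph without a cut vertex. $K_{1,1,2}$ is the complete multipartite graph with parts of sizes $1,1,2$ (i.e. $K_4$ minus an edge). $C'_5$ is the graph on vertex set $\mathbb{Z}_5$ with edges $\{i,i+1\}$ for $i\in\mathbb{Z}_5$ together with the two chords $\{1,3\},\{2,4\}$. *)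

(* Defs.v *)
From HB Require Import structures.
From mathcomp Require Import all_boot all_order all_algebra.

Set Implicit Arguments.
Unset Strict Implicit.
Unset Printing Implicit Defensive.

Import Order.TTheory GRing.Theory Num.Theory.

Local Open Scope ring_scope.

(* A graph on the vertex type T is given by its adjacency relation. *)
Section Graphs.
Variables (T : finType) (e : rel T).
Implicit Types (u v x y : T) (U : {set T}) (d : rel T).

Definition simple_graph : Prop := symmetric e /\ irreflexive e.

Definition connected_graph : Prop :=
  (0 < #|T|)%N /\ forall x y, connect e x y.

Definition edge_set : {set {set T}} :=
  [set [set p.1; p.2] | p : T * T & e p.1 p.2].

Definition edge : finType := {f : {set T} | f \in edge_set}.

(* For sets of edges, trivIset means that they are pairwise disjoint. *)
Definition matching (m : {set {set T}}) : bool :=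
  (m \subset edge_set) && trivIset m.

Definition degree v : nat := #|[set w | e v w]|.

Definition essential u : Prop :=
  [\/ degree u = 1%N /\ (forall w, e u w -> degree w = 1%N),
      degree u = 2%N /\ (forall v w, e u v -> e u w -> v != w -> ~~ e v w)
    | (3 <= degree u)%N].

Definition bipartite : Prop :=
  exists A : {set T}, forall x y, e x y -> (x \in A) != (y \in A).

(* (U, d) stands for the subgraph with vertex set U and adjacency relation d;
   it need not be induced. *)
Definition subgraph U d : Prop :=
  symmetric d /\ forall x y, d x y -> [/\ x \in U, y \in U & e x y].

Definition connected_subgraph U d : Prop :=
  [/\ subgraph U d, U != set0 & {in U &, forall x y, connect d x y}].

Definition del_vertex d v : rel T := [rel x y | [&& d x y, x != v & y != v]].

Definition cut_vertex U d v : Prop :=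
  v \in U /\
  exists x y, [/\ x \in U :\ v, y \in U :\ v,
                  connect d x y & ~~ connect (del_vertex d v) x y].

Definition nonseparable U d : Prop :=
  connected_subgraph U d /\ forall v, ~ cut_vertex U d v.

Definition block U d : Prop :=
  nonseparable U d /\
  forall U' d', nonseparable U' d' -> U \subset U' -> subrel d d' ->
    U' = U /\ d' =2 d.

End Graphs.

(* The subgraph (U, d) as a graph on its own vertex type. *)
Definition subgraph_rel (T : finType) (U : {set T}) (d : rel T) :
  rel {x : T | x \in U} := relpre val d.
Arguments subgraph_rel {T} U d _ _.

Definition graph_iso (T1 T2 : finType) (e1 : rel T1) (e2 : rel T2) : Prop :=
  exists2 f : T1 -> T2, bijective f & forall x y, e1 x y = e2 (f x) (f y).

Definition complete_graph (n : nat) : rel 'I_n := [rel i j | i != j].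
Arguments complete_graph n _ _ : clear implicits.

Definition complete_multipartite (n : nat) (s : n.-tuple nat) :
  rel {i : 'I_n & 'I_(tnth s i)} := [rel x y | tag x != tag y].
Arguments complete_multipartite {n} s _ _.

Definition K112 := complete_multipartite [tuple 1; 1; 2]%N.

Definition C5 : rel 'Z_5 := [rel i j | (j == i + 1) || (i == j + 1)].

Definition C5' : rel 'Z_5 :=
  [rel i j | C5 i j || ((i, j) \in [:: (1, 3); (3, 1); (2, 4); (4, 2)])].

From mathcomp Require Import boolp classical_sets reals.
Local Open Scope classical_set_scope.

(* Polytopes in R^I, for a finite index type I.  The codomain is R^o so that
   {ffun I -> R^o} is a left R-module. *)
Section LatticePolytopes.
Variables (R : realType) (I : finType).
Local Notation V := {ffun I -> R^o}.
Implicit Types (P X : set V) (a : {ffun I -> int}).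

Definition conv_hull X : set V :=
  [set x | exists n (v : 'I_n -> V) (c : 'I_n -> R),
      [/\ forall i, X (v i), forall i, 0 <= c i, \sum_i c i = 1
        & x = \sum_i c i *: v i]].

Definition lattice_point a : V := [ffun i => (a i)%:~R].

Definition lattice_polytope P : Prop :=
  exists s : seq {ffun I -> int},
    P = conv_hull [set lattice_point a | a in [set` s]].

Definition dotp (x y : V) : R := \sum_i x i * y i.

Definition polar_dual P : set V := [set y | forall x, P x -> - 1 <= dotp x y].

Definition reflexive_polytope P : Prop :=
  lattice_polytope P /\ lattice_polytope (polar_dual P).

Definition gorenstein P : Prop :=
  lattice_polytope P /\
  exists (k : nat) a, (0 < k)%N /\
    reflexive_polytope [set k%:R *: x - lattice_point a | x in P].

End LatticePolytopes.

Definition matching_vector (R : realType) (T : finType) (e : rel T)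
    (m : {set {set T}}) : {ffun edge e -> R^o} :=
  [ffun f => (val f \in m)%:R].
Arguments matching_vector R {T} e m.

Definition matching_polytope (R : realType) (T : finType) (e : rel T) :
  set {ffun edge e -> R^o} :=
  conv_hull [set matching_vector R e m | m in [set m | matching e m]].
Arguments matching_polytope R {T} e _.

(* Main.v *)
(** Write P for the matching polytope.  The coordinate facets x_f >= 0 force any
    lattice translate of kP that is reflexive to be kP - (1, ..., 1), and then P
    is Gorenstein iff every facet a.x <= b satisfies k b - sum a = 1.  By
    Edmonds' theorem the remaining facets come from essential vertices v, where
    the condition reads deg v = k - 1, and from nonseparable factor-critical
    sets S, where it reads |E(S)| = k (|S| - 1) / 2 - 1.

    Edmonds' theorem is used in the form of LP duality: by Gallai's lemma, the
    maximum-weight matchings for a nonzero weight all lie on one of the listed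
    facets, and subtracting multiples of such facet normals writes the weight as
    their nonnegative combination.

    Conversely, only facets spanned by odd cycles are needed.  A chordless odd
    cycle of length 2m + 1 gives m (k - 2) = 2, so k = 3 with a 5-cycle, which is
    then the whole graph, or k = 4 with a triangle.  When k = 4 the degrees are at
    most 3 and odd cycles have length 3, or 5 with two chords; extending a
    triangle by ears inside its block leaves only K3, K4, K112 and C5'. *)

Require Import Defs.
From mathcomp Require Import all_boot all_order all_algebra.
From mathcomp Require Import zify ring lra.
From mathcomp Require Import boolp.

Set Implicit Arguments.
Unset Strict Implicit.
Unset Printing Implicit Defensive.

Import Order.TTheory GRing.Theory Num.Theory.

(** * Matchings *)

(** If a.x <= b defines a facet of P, then -a / (kb - a.al) is the corresponding vertex of the polar
    dual of kP - al. The normals in play have an entry 1 or -1, hence are primitive, and this vertex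
    is a lattice point only if the denominator is 1; for x_f >= 0 the denominator is the coordinate
    of al at f.

    The two directions ask for different knowledge, which shapes the proof. To use that P is
    Gorenstein, an inequality must be known to define a facet; in place of a dimension count, it is
    shown that every functional constant on the face is a multiple of the normal, by exchanging one
    edge of a tight matching. To prove that P is Gorenstein, the list of inequalities must be
    complete, yet every member of it must satisfy the numerical condition. So the list has to avoid
    redundant members: two triangles sharing a vertex form a factor-critical set with six edges
    where k = 4 would ask for seven, and a leaf of a longer path has the wrong degree. Hence the
    reductions from arbitrary vertices and odd sets to essential vertices and nonseparable sets. *)

Section Matchings.
Variables (T : finType) (e : rel T).
Hypothesis simple_e : simple_graph e.
Implicit Types (x y z : T) (M N : {set {set T}}) (D S : {set T}) (s l : seq T).

Let sym_e : symmetric e := simple_e.1.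
Let irr_e : irreflexive e := simple_e.2.

Lemma edge_neq x y : e x y -> x != y.
Proof. by apply: contraTneq => ->; rewrite irr_e. Qed.

Lemma edge_setP f :
  reflect (exists x y, e x y /\ f = [set x; y]) (f \in edge_set e).
Proof.
apply: (iffP imsetP) => [[[x y]] /=|[x [y [exy ->]]]].
  by rewrite inE /= => exy ->; exists x, y.
by exists (x, y); rewrite ?inE.
Qed.

Lemma mem_edge_set x y : ([set x; y] \in edge_set e) = e x y.
Proof.
apply/edge_setP/idP => [[a [b [eab /setP eq]]]|exy]; last by exists x, y.
have nab := edge_neq eab; have := eq x; have := eq y; have := eq a; have := eq b.
rewrite !inE !eqxx ?orbT /= => abxy aaxy /esym/orP[]/eqP yE /esym/orP[]/eqP xE; subst.
- by move: abxy; rewrite orbb eq_sym (negbTE nab).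
- by rewrite sym_e.
- exact: eab.
- by move: aaxy; rewrite orbb (negbTE nab).
Qed.

Lemma card_edge f : f \in edge_set e -> #|f| = 2.
Proof. by case/edge_setP => x [y [exy ->]]; rewrite cards2 edge_neq. Qed.

Lemma matching_edge M x y : matching e M -> [set x; y] \in M -> e x y.
Proof. by case/andP => /subsetP sub _ /sub; rewrite mem_edge_set. Qed.

Lemma matchingS M N : N \subset M -> matching e M -> matching e N.
Proof.
move=> sNM /andP[sM tM]; rewrite /matching (subset_trans sNM sM) /=.
exact: trivIsetS tM.
Qed.

Lemma matching0 : matching e set0.
Proof. by rewrite /matching sub0set; apply/trivIsetP => A B; rewrite inE. Qed.

Lemma coverP M x :
  reflect (exists2 f, f \in M & x \in f) (x \in cover M).
Proof. exact: bigcupP. Qed.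

Lemma matching_disj M f g x :
  matching e M -> f \in M -> g \in M -> x \in f -> x \in g -> f = g.
Proof.
case/andP => _ /trivIsetP tM fM gM xf xg; apply/eqP.
case: (eqVneq f g) => // /(tM _ _ fM gM) /pred0P /(_ x) /=.
by rewrite xf xg.
Qed.

Lemma matching_neigh M x y f :
  matching e M -> [set x; y] \in M -> f \in M -> x \in f -> f = [set x; y].
Proof. by move=> mM xyM fM xf; apply: (matching_disj mM fM xyM xf); rewrite !inE eqxx. Qed.

Lemma edge_partner f x : f \in edge_set e -> x \in f ->
  exists2 y, e x y & f = [set x; y].
Proof.
case/edge_setP => a [b [eab ->]]; rewrite !inE => /orP[/eqP ->|/eqP ->].
  by exists b.
by exists a; rewrite ?[[set a; b]]setUC // sym_e.
Qed.

Lemma cover_partner M x : matching e M -> x \in cover M ->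
  exists2 y, e x y & [set x; y] \in M.
Proof.
case/andP => /subsetP sM _ /coverP[f fM xf].
by have [y exy def_f] := edge_partner (sM _ fM) xf; exists y; rewrite -?def_f.
Qed.

Lemma set2_injr x y z : x != y -> [set x; y] = [set x; z] -> y = z.
Proof.
move=> nxy /setP /(_ y); rewrite !inE eqxx orbT eq_sym (negbTE nxy) /=.
by move/esym/eqP.
Qed.

Lemma partner_uniq M x y z : matching e M ->
  [set x; y] \in M -> [set x; z] \in M -> y = z.
Proof.
move=> mM xyM xzM; apply: (@set2_injr x); first exact/edge_neq/(matching_edge mM).
by apply: (matching_neigh mM xzM xyM); rewrite !inE eqxx.
Qed.

Lemma matching_add M x y : matching e M -> e x y ->
  x \notin cover M -> y \notin cover M -> matching e ([set x; y] |: M).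
Proof.
move=> mM exy xM yM; case/andP: (mM) => sM /trivIsetP tM.
rewrite /matching subUset sub1set mem_edge_set exy sM /=.
have disj B : B \in M -> [disjoint [set x; y] & B].
  move=> BM; rewrite disjoint_sym disjoints_subset; apply/subsetP => z zB.
  have zM : z \in cover M by apply/coverP; exists B.
  by rewrite !inE negb_or !(contraTneq _ zM) // => ->.
apply/trivIsetP => A B; rewrite !inE => /orP[/eqP ->|AM] /orP[/eqP ->|BM].
- by rewrite eqxx.
- by move=> _; apply: disj.
- by move=> _; rewrite disjoint_sym; apply: disj.
- exact: tM.
Qed.

Lemma matching_set1 f : f \in edge_set e -> matching e [set f].
Proof.
case/edge_setP => x [y [exy ->]]; have := matching_add matching0 exy.
by rewrite setU0 /cover big_set0 !in_set0; apply.
Qed.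

Lemma coverU1 M f : cover (f |: M) = f :|: cover M.
Proof. by rewrite /cover bigcup_setU big_set1. Qed.

Lemma cover_set1 (f : {set T}) : cover [set f] = f.
Proof. by rewrite /cover big_set1. Qed.

Lemma card_cover M : matching e M -> #|cover M| = #|M|.*2.
Proof.
case/andP => /subsetP sM /eqP <-.
rewrite (eq_bigr (fun=> 2)) ?sum_nat_const ?muln2 // => f /sM; exact: card_edge.
Qed.

Definition within M D : {set {set T}} := [set f in M | f \subset D].

Lemma within_sub M D : within M D \subset M.
Proof. by apply/subsetP => f; rewrite inE => /andP[]. Qed.

Lemma matching_within M D : matching e M -> matching e (within M D).
Proof. exact/matchingS/within_sub. Qed.

Lemma cover_within_sub M D : cover (within M D) \subset D.
Proof.
apply/subsetP => x /coverP[f]; rewrite inE => /andP[_ /subsetP fD]; exact: fD.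
Qed.

Lemma cover_within M D :
  (forall f x, f \in M -> x \in f -> x \in D -> f \subset D) ->
  cover (within M D) = cover M :&: D.
Proof.
move=> clD; apply/setP => x; rewrite inE; apply/coverP/andP => [[f]|[/coverP[f fM xf] xD]].
  rewrite inE => /andP[fM /subsetP fD] xf; split; last exact: fD.
  by apply/coverP; exists f.
by exists f => //; rewrite inE fM (clD f x).
Qed.

Definition ecount D : nat := #|within (edge_set e) D|.

Lemma within_card_le M D : matching e M -> #|within M D|.*2 <= #|D|.
Proof.
move=> mM; rewrite -card_cover ?matching_within //.
exact/subset_leq_card/cover_within_sub.
Qed.

Lemma within_card_odd M D : matching e M -> odd #|D| -> #|within M D|.*2 < #|D|.
Proof.
move=> mM oD; rewrite ltn_neqAle within_card_le // andbT.
by apply: contraTneq oD => <-; rewrite odd_double.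
Qed.

Lemma handshake D : \sum_(x in D) #|[set y in D | e x y]| = (ecount D).*2.
Proof.
have deg x : x \in D ->
    #|[set y in D | e x y]| = \sum_(f in within (edge_set e) D) (x \in f).
  move=> xD; rewrite -big_mkcondr sum1dep_card.
  rewrite -(@card_in_imset _ _ (fun y => [set x; y])); last first.
    move=> y z; rewrite !inE => /andP[_ exy] _; exact/set2_injr/edge_neq.
  apply: eq_card => f; rewrite !inE; apply/imsetP/andP => [[y]|[]].
    rewrite inE => /andP[yD exy] ->; rewrite mem_edge_set exy !inE eqxx.
    by rewrite subUset !sub1set xD yD.
  move=> /andP[fE fD] xf; have [y exy def_f] := edge_partner fE xf.
  exists y => //; rewrite inE exy andbT.
  by apply: (subsetP fD); rewrite def_f !inE eqxx orbT.
rewrite (eq_bigr _ deg) exchange_big /= (eq_bigr (fun=> 2)).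
  by rewrite sum_nat_const muln2.
move=> f; rewrite inE => /andP[fE fD].
rewrite -(card_edge fE) -big_mkcondr -sum1_card; apply: eq_bigl => x.
rewrite -[in RHS](setIidPl fD) !inE andbC; congr (_ && _).
Qed.

Lemma degree_edges x : #|[set f in edge_set e | x \in f]| = degree e x.
Proof.
rewrite /degree -(@card_in_imset _ _ (fun y => [set x; y])); last first.
  move=> y z; rewrite !inE => exy _; exact/set2_injr/edge_neq.
apply: eq_card => f; rewrite !inE; apply/andP/imsetP => [[fE xf]|[y]].
  by have [y exy ->] := edge_partner fE xf; exists y => //; rewrite inE.
by rewrite inE => exy ->; rewrite mem_edge_set exy !inE eqxx.
Qed.

(* The list [:: x1; y1; x2; y2; ...] encodes the matching {x1 y1, x2 y2, ...}. *)
Fixpoint pairs l : {set {set T}} :=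
  if l is x :: y :: l' then [set x; y] |: pairs l' else set0.

Fixpoint adjacent_pairs l : bool :=
  match l with
  | x :: y :: l' => e x y && adjacent_pairs l'
  | [::] => true
  | _ => false
  end.

Lemma seq2_ind (P : seq T -> Prop) :
  P [::] -> (forall x, P [:: x]) -> (forall x y l, P l -> P [:: x, y & l]) ->
  forall l, P l.
Proof.
move=> P0 P1 P2 l; have [n] := ubnP (size l); elim: n l => // n IHn.
case=> [|x [|y l]] //= lt_n; apply: P2; apply: IHn; lia.
Qed.

Lemma cover_pairs l : adjacent_pairs l -> cover (pairs l) = [set x in l].
Proof.
elim/seq2_ind: l => [|x|x y l IHl] //=.
  move=> _; apply/setP => x; rewrite inE; apply/coverP => -[f]; by rewrite inE.
case/andP => _ /IHl; rewrite coverU1 => ->.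
by apply/setP => z; rewrite !inE orbA.
Qed.

Lemma matching_pairs l : adjacent_pairs l -> uniq l -> matching e (pairs l).
Proof.
elim/seq2_ind: l => [|x|x y l IHl] //=; first by rewrite matching0.
case/andP => exy al; rewrite inE negb_or -!andbA => /and4P[_ xl yl ul].
by apply: matching_add; rewrite ?cover_pairs ?inE ?IHl.
Qed.

Lemma pairs_notin x y l : adjacent_pairs l -> x \notin l -> [set x; y] \notin pairs l.
Proof.
move=> al; apply: contra => xyl; have: x \in cover (pairs l).
  by apply/coverP; exists [set x; y]; rewrite ?inE ?eqxx.
by rewrite cover_pairs // inE.
Qed.

Lemma sum_pairs (V : nmodType) (W : {set T} -> V) x y l :
  adjacent_pairs [:: x, y & l] -> uniq [:: x, y & l] ->
  (\sum_(f in pairs [:: x, y & l]) W f = W [set x; y] + \sum_(f in pairs l) W f)%R.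
Proof.
move=> /= /andP[exy al]; rewrite inE negb_or -!andbA => /and4P[_ xl yl ul].
by rewrite big_setU1 // pairs_notin.
Qed.

Lemma adjacent_pairs_cat l1 l2 : ~~ odd (size l1) ->
  adjacent_pairs (l1 ++ l2) = adjacent_pairs l1 && adjacent_pairs l2.
Proof.
by elim/seq2_ind: l1 => [|x|x y l IHl] //=; rewrite negbK => /IHl ->; rewrite andbA.
Qed.

(** The pairs are the second, fourth, ... edges of the path, so the starting vertex [x] stays
    free. *)
Lemma path_pairs x l : path e x l -> ~~ odd (size l) -> adjacent_pairs l.
Proof.
elim/seq2_ind: l x => [|x|y z l IHl] //= x; rewrite negbK => /and3P[_ eyz pl] ol.
by rewrite eyz (IHl z).
Qed.

End Matchings.

(** * Gallai's lemma *)

Section MaximumWeight.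
Variables (T : finType) (e : rel T) (R : realFieldType) (W : {set T} -> R).
Hypothesis simple_e : simple_graph e.
Implicit Types (x y z u v t : T) (M N : {set {set T}}) (D S C : {set T}).

Let sym_e : symmetric e := simple_e.1.

Definition weight M : R := (\sum_(f in M) W f)%R.

Definition max_weight M : Prop :=
  matching e M /\ forall N, matching e N -> (weight N <= weight M)%R.

Lemma max_weight_exists : exists M, max_weight M.
Proof.
have [M mM maxM] := @arg_maxP _ _ _ set0 (matching e) weight (matching0 e).
by exists M.
Qed.

Lemma weightD1 M f : f \in M -> weight M = (W f + weight (M :\ f))%R.
Proof. exact: big_setD1. Qed.

Lemma coverD1 M f : matching e M -> f \in M -> cover (M :\ f) = cover M :\: f.
Proof.
move=> mM fM; apply/setP => x; rewrite !inE; apply/coverP/andP => [[g]|[xf]].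
  rewrite !inE => /andP[gf gM] xg; split; last by apply/coverP; exists g.
  by apply: contraNN gf => xf; apply/eqP; apply: matching_disj mM gM fM xg xf.
case/coverP => g gM xg; exists g => //; rewrite !inE gM andbT.
by apply: contraNneq xf => <-.
Qed.

Lemma max_weight_ge0 M f : max_weight M -> f \in M -> (0 <= W f)%R.
Proof.
case=> mM maxM fM; have := maxM (M :\ f) (matchingS (subD1set M f) mM).
rewrite (weightD1 fM); lra.
Qed.

Lemma max_weight_remove M f : max_weight M -> f \in M -> W f = 0%R ->
  max_weight (M :\ f).
Proof.
case=> mM maxM fM Wf; split; first exact: matchingS (subD1set M f) mM.
by move=> N /maxM; rewrite (weightD1 fM) Wf add0r.
Qed.

Lemma matchingU M N : matching e M -> matching e N ->
  [disjoint cover M & cover N] -> matching e (M :|: N).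
Proof.
move=> /andP[sM /trivIsetP tM] /andP[sN /trivIsetP tN] dMN.
rewrite /matching subUset sM sN /=.
have dis A B : A \in M -> B \in N -> [disjoint A & B].
  move=> AM BN; apply: disjointWl (disjointWr _ dMN).
    by apply/subsetP => x xA; apply/coverP; exists A.
  by apply/subsetP => x xB; apply/coverP; exists B.
apply/trivIsetP => A B; rewrite !inE => /orP[AM|AN] /orP[BM|BN].
- exact: tM.
- by move=> _; apply: dis.
- by move=> _; rewrite disjoint_sym; apply: dis.
- exact: tN.
Qed.

(** By the default value an uncovered vertex is its own mate. Thus [mate M] is an involution of all
    of [T], and the composite of two mates is a permutation whose orbits trace alternating paths. *)
Definition mate M x : T := odflt x [pick y | [set x; y] \in M].

Lemma mate_in M x y : matching e M -> [set x; y] \in M -> mate M x = y.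
Proof.
move=> mM xyM; rewrite /mate; case: pickP => [z xzM|/(_ y)]; last by rewrite xyM.
exact: (partner_uniq simple_e mM xzM xyM).
Qed.

Lemma mate_out M x : x \notin cover M -> mate M x = x.
Proof.
move=> xM; rewrite /mate; case: pickP => // z xzM; case/negP: xM.
by apply/coverP; exists [set x; z]; rewrite ?inE ?eqxx.
Qed.

Lemma mateK M : matching e M -> involutive (mate M).
Proof.
move=> mM x; case: (boolP (x \in cover M)) => [/(cover_partner simple_e mM)[y _ xyM]|xM].
  by rewrite (mate_in mM xyM); apply: mate_in; rewrite // setUC.
by rewrite !(mate_out xM).
Qed.

Lemma mate_closed M C f x : matching e M -> (forall y, y \in C -> mate M y \in C) ->
  f \in M -> x \in f -> x \in C -> f \subset C.
Proof.
move=> mM clC fM xf xC; case/andP: (mM) => /subsetP/(_ _ fM) fE _.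
have [y _ def_f] := edge_partner simple_e fE xf.
rewrite def_f subUset !sub1set xC /= -(@mate_in M x y) ?clC //; by rewrite -def_f.
Qed.

Definition switch C M N : {set {set T}} := (M :\: powerset C) :|: (N :&: powerset C).

(** Edges of [M] that meet [C] lie inside [C] and are dropped, so the kept ones avoid [C], where all
    the new edges live. *)
Lemma matching_switch C M N : matching e M -> matching e N ->
  (forall f x, f \in M -> x \in f -> x \in C -> f \subset C) ->
  matching e (switch C M N).
Proof.
move=> mM mN clM; apply: matchingU.
- exact: matchingS (subsetDl _ _) mM.
- exact: matchingS (subsetIl _ _) mN.
apply/pred0P => x /=; apply/negP => /andP[/coverP[f]].
rewrite !inE => /andP[fC fM] xf /coverP[g]; rewrite !inE => /andP[gN /subsetP gC] xg.
by rewrite (clM f x fM xf (gC x xg)) in fC.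
Qed.

Lemma weight_switch C M N :
  (weight (switch C M N) + weight (switch C N M) = weight M + weight N)%R.
Proof.
have eqI A B : switch C A B :&: powerset C = B :&: powerset C.
  by apply/setP => f; rewrite !inE; case: (f \subset C); rewrite ?andbF ?andbT.
have eqD A B : switch C A B :\: powerset C = A :\: powerset C.
  by apply/setP => f; rewrite !inE; case: (f \subset C); rewrite ?andbF ?andbT ?orbF.
rewrite /weight (big_setID (powerset C)) /= eqI eqD.
rewrite [X in (_ + X)%R](big_setID (powerset C)) /= eqI eqD.
rewrite [X in _ = (X + _)%R](big_setID (powerset C)) /=.
rewrite [X in _ = (_ + X)%R](big_setID (powerset C)) /=; ring.
Qed.

(** The two exchanged matchings together weigh as much as [M] and [N], so neither can fall below the
    maximum. *)
Lemma max_weight_switch C M N : max_weight M -> max_weight N ->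
  (forall f x, f \in M -> x \in f -> x \in C -> f \subset C) ->
  (forall f x, f \in N -> x \in f -> x \in C -> f \subset C) ->
  max_weight (switch C M N).
Proof.
move=> [mM maxM] [mN maxN] clM clN; have mMN := matching_switch mM mN clM.
have mNM := matching_switch mN mM clN.
split=> // L mL; have := weight_switch C M N; have := maxN _ mNM; have := maxM _ mL.
lra.
Qed.

(* The alternating path in M :|: N starting at t is the orbit of t under
   mate N \o mate M; reversing it shows that an end u of it other than t is
   iter i f t with 2 i + 1 the length of the orbit, so it is unique. *)
Lemma alternating_end M N t u v (f := mate N \o mate M) :
  matching e M -> matching e N ->
  t \notin cover N -> u \notin cover M -> v \notin cover M ->
  fconnect f t u -> fconnect f t v -> u = v.
Proof.
move=> mM mN tN uM vM.
have KM := mateK mM; have KN := mateK mN.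
have inj_f : injective f by apply: inj_comp; apply: can_inj.
(* The involution [mate M] conjugates [f] to its inverse. *)
have rev i x : iter i f (mate M (iter i f x)) = mate M x.
  elim: i x => // i IHi x; rewrite iterSr iterS /f /= !KM KN; exact: IHi.
have odd_idx w : w \notin cover M -> fconnect f t w -> (findex f t w).*2.+1 = order f t.
  move=> wM tw; set i := findex f t w.
  have iw : iter i f t = w by apply: iter_findex.
  have it : iter i.*2.+1 f t = t.
    rewrite -addnn -addSn iterD iw -{1}(mate_out wM) iterS -{1}iw rev.
    by rewrite /f /= KM mate_out.
  have lt_i : i < order f t by apply: findex_max.
  have idx j : j < order f t -> iter j f t = t -> j = 0.
    by move=> lt_j ij; rewrite -(findex_iter lt_j) ij findex0.
  (* As i is below the length of the orbit, 2i + 1 is less than twice that length: after at most one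
     full turn is removed, the remaining return time to [t] is below the length and hence zero. *)
  case: (ltnP i.*2.+1 (order f t)) => [/idx/(_ it) //|le_i].
  have ij : iter (i.*2.+1 - order f t) f t = t.
    by rewrite -[RHS]it -[in RHS](subnK le_i) iterD iter_order.
  have := idx _ _ ij; lia.
move=> tu tv; have eq_idx : findex f t u = findex f t v.
  by apply: double_inj; apply: succn_inj; rewrite !odd_idx.
by rewrite -(iter_findex tu) eq_idx iter_findex.
Qed.

Definition exclusive u v : Prop :=
  forall M, max_weight M -> u \notin cover M -> v \in cover M.

Lemma exclusive_sym u v : exclusive u v -> exclusive v u.
Proof. by move=> uv M maxM; apply: contraNT => /(uv M maxM). Qed.

(* Gallai's lemma: if M misses u and v and N misses t, exchanging M and N along
   the alternating path from t leaves t and one of u, v uncovered. *)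
Lemma exclusive_trans N t u v : max_weight N -> t \notin cover N -> u != v ->
  exclusive u t -> exclusive t v -> exclusive u v.
Proof.
move=> maxN tN nuv ut tv M maxM uM; apply/negPn/negP => vM.
have [mM mN] := (maxM.1, maxN.1).
pose f := mate N \o mate M; pose C := [set x | fconnect f t x].
have KM := mateK mM; have KN := mateK mN.
have inj_f : injective f by apply: inj_comp; apply: can_inj.
have clf x : (f x \in C) = (x \in C).
  by rewrite !inE; apply/idP/idP => tx; apply: connect_trans tx _;
     rewrite ?fconnect1 // fconnect_sym // fconnect1.
have clM x : x \in C -> mate M x \in C.
  rewrite !inE => /iter_findex; set i := findex _ _ _ => ix.
  have rev j y : iter j f (mate M (iter j f y)) = mate M y.
    elim: j y => // j IHj y; rewrite iterSr iterS /f /= !KM KN; exact: IHj.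
  have := rev i t; rewrite ix => eq_i; rewrite fconnect_sym //.
  have <- : iter i.+1 f (mate M x) = t by rewrite iterS eq_i /f /= KM mate_out.
  exact: fconnect_iter.
have clN x : x \in C -> mate N x \in C.
  by move=> xC; have <- : f (mate M x) = mate N x; [rewrite /f /= KM | rewrite clf clM].
have clMe g x := @mate_closed M C g x mM clM.
have clNe g x := @mate_closed N C g x mN clN.
have maxM' := max_weight_switch maxM maxN clMe clNe.
have tC : t \in C by rewrite inE connect0.
have tM' : t \notin cover (switch C M N).
  apply/negP => /coverP[g]; rewrite !inE => /orP[/andP[gC gM] tg|/andP[gN _] tg].
    by rewrite (clMe g t) in gC.
  by case/negP: tN; apply/coverP; exists g.
(* An uncovered vertex of [M] off the orbit would stay uncovered after the exchange, together with
   [t]. So [u] and [v] both lie on the orbit, against the uniqueness of its end. *)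
have inC w : w \notin cover M -> exclusive w t -> w \in C.
  move=> wM wt; apply: contraT => wC; case/negP: tM'; apply: wt => //.
  apply/negP => /coverP[g]; rewrite !inE => /orP[/andP[gC gM] wg|/andP[gN gC] wg].
    by case/negP: wM; apply/coverP; exists g.
  by rewrite (subsetP gC) in wC.
move: (inC u uM ut) (inC v vM (exclusive_sym tv)); rewrite !inE => tu tv'.
by rewrite (alternating_end mM mN tN uM vM tu tv') eqxx in nuv.
Qed.

Definition factor_critical S : Prop :=
  forall s, s \in S -> exists2 M, matching e M & cover M = S :\ s.

(** Equality in the odd-set constraint: the number of edges of [M] inside [S] is (|S| - 1) / 2.
    Other edges of [M] may leave [S] or lie elsewhere. *)
Definition near_perfect S M : Prop := #|within M S|.*2.+1 = #|S|.

(** Weights are nonnegative because every edge is used by some optimum, and the ends of an edge of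
    positive weight are never both missed. By transitivity any two vertices of a component [S] of
    the positive edges are exclusive. An optimum missing [s] in [S] therefore covers the rest of
    [S], and from within: an edge leaving [S] has weight 0, and dropping it would expose a second
    vertex of [S]. *)
Lemma max_weight_near_perfect :
  (forall f, f \in edge_set e -> exists2 M, max_weight M & f \in M) ->
  (forall v, exists2 M, max_weight M & v \notin cover M) ->
  (exists2 f, f \in edge_set e & W f != 0%R) ->
  exists S, [/\ factor_critical S, 2 < #|S|
              & forall M, max_weight M -> near_perfect S M].
Proof.
move=> used missed [f0 f0E Wf0].
have W_ge0 f : f \in edge_set e -> (0 <= W f)%R.
  by case/used => M maxM; apply: max_weight_ge0.
have [a [b [eab def_f0]]] := edge_setP _ _ f0E.
pose pos x y := e x y && (0 < W [set x; y])%R.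
pose S := [set x | connect pos a x].
have sym_pos : symmetric pos by move=> x y; rewrite /pos sym_e setUC.
have excl_pos x y : pos x y -> exclusive x y.
  case/andP => exy Wxy M [mM maxM] xM; apply: contraT => yM.
  have := maxM _ (matching_add simple_e mM exy xM yM).
  rewrite /weight big_setU1 /=; first by lra.
  by apply: contra xM => xyM; apply/coverP; exists [set x; y]; rewrite ?inE ?eqxx.
have excl_path p x : path pos x p -> x != last x p -> exclusive x (last x p).
  elim: p x => [|z p IHp] x /=; first by rewrite eqxx.
  case/andP => xz zp nx; case: (eqVneq z (last z p)) => [<-|nz]; first exact: excl_pos.
  have [N maxN zN] := missed z.
  exact: exclusive_trans maxN zN nx (excl_pos _ _ xz) (IHp z zp nz).
have excl x y : x \in S -> y \in S -> x != y -> exclusive x y.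
  rewrite !inE => ax ay; have /connectP[p xp ->] : connect pos x y.
    by apply: connect_trans ay; rewrite sym_connect_sym.
  exact: excl_path.
have posS x y : x \in S -> pos x y -> y \in S.
  by rewrite !inE => ax xy; apply: connect_trans ax (connect1 xy).
have cross M f x : max_weight M -> f \in M -> x \in f -> x \in S ->
    ~~ (f \subset S) -> W f = 0%R.
  move=> maxM fM xf xS fS; case/andP: (maxM.1) => /subsetP/(_ _ fM) fE _.
  have [y exy def_f] := edge_partner simple_e fE xf.
  apply/eqP; rewrite eq_le W_ge0 // andbT leNgt; apply: contra fS => Wf.
  by rewrite def_f subUset !sub1set xS (posS x) // /pos exy -def_f.
have near M s : max_weight M -> s \in S -> s \notin cover M ->
    cover (within M S) = S :\ s.
  move=> maxM sS sM; rewrite cover_within => [|f x fM xf xS]; last first.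
    apply: contraT => fS; have Wf := cross M f x maxM fM xf xS fS.
    have maxM' := max_weight_remove maxM fM Wf.
    have cM' := coverD1 maxM.1 fM.
    have nsx : s != x by apply: contraNneq sM => ->; apply/coverP; exists f.
    have := excl s x sS xS nsx _ maxM'; rewrite cM' !inE xf (negbTE sM) andbF.
    by move/(_ isT).
  apply/setP => x; rewrite !inE; case: (eqVneq x s) => [->|nxs] /=.
    by rewrite (negbTE sM).
  case xS: (connect pos a x); rewrite ?andbF // andbT.
  by apply: (excl s x) => //; rewrite ?inE // eq_sym.
have aS : a \in S by rewrite inE connect0.
have npM M s : max_weight M -> s \in S -> s \notin cover M -> near_perfect S M.
  move=> maxM sS sM; have := card_cover simple_e (matching_within S maxM.1).
  by rewrite (near M s) // => eqc; rewrite /near_perfect -eqc [RHS](cardsD1 s) sS.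
have [M0 maxM0 aM0] := missed a; have := npM M0 a maxM0 aS aM0 => npM0.
have oS : odd #|S| by rewrite -npM0 /= odd_double.
have bS : b \in S.
  by rewrite inE connect1 // /pos eab -def_f0 lt_def Wf0 W_ge0.
exists S; split.
- move=> s sS; have [M maxM sM] := missed s.
  by exists (within M S); [apply: matching_within maxM.1 | apply: near].
- have : #|S| != 2 by apply: contraTneq oS => ->.
  have : 1 < #|S|.
    by apply/card_gt1P; exists a, b; rewrite aS bS (edge_neq simple_e eab).
  lia.
move=> M maxM; case: (boolP [forall s in S, s \in cover M]); last first.
  by case/forall_inPn => s sS sM; apply: npM sM.
move/forall_inP => covS.
(* If [M] covers the odd set [S], some edge of [M] leaves [S]. It has weight 0, and dropping it
   keeps the edges inside [S] while exposing a vertex of [S]. *)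
case: (boolP [forall f in M, [forall x in f, (x \in S) ==> (f \subset S)]]).
  move/forall_inP => clS; have := card_cover simple_e (matching_within S maxM.1).
  rewrite cover_within => [|f x fM xf xS]; last first.
    by have /forall_inP/(_ x xf)/implyP/(_ xS) := clS f fM.
  have /setIidPr -> : S \subset cover M by apply/subsetP.
  by move=> eqS; rewrite eqS odd_double in oS.
case/forall_inPn => f fM /forall_inPn[x xf]; rewrite negb_imply => /andP[xS fS].
have Wf := cross M f x maxM fM xf xS fS.
have maxM' := max_weight_remove maxM fM Wf.
have xM' : x \notin cover (M :\ f) by rewrite (coverD1 maxM.1 fM) !inE xf.
have := npM _ x maxM' xS xM'; rewrite /near_perfect => <-; congr (_.*2.+1).
apply: eq_card => g; rewrite !inE; case: eqP => //= ->; rewrite (negbTE fS).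
by rewrite !andbF.
Qed.

End MaximumWeight.

(** * Factor-critical sets *)

Definition induced_rel (T : finType) (e : rel T) (U : {set T}) : rel T :=
  [rel x y | [&& x \in U, y \in U & e x y]].

Section FactorCritical.
Variables (T : finType) (e : rel T).
Hypothesis simple_e : simple_graph e.
Implicit Types (x y z u v : T) (M N : {set {set T}}) (C D S U : {set T}).

Let sym_e : symmetric e := simple_e.1.

Lemma induced_sym U : symmetric (induced_rel e U).
Proof. by move=> x y; rewrite /induced_rel /= sym_e andbCA. Qed.

Lemma induced_subgraph U : subgraph e U (induced_rel e U).
Proof. by split; [apply: induced_sym | move=> x y /and3P[]]. Qed.

Lemma matching_even M D : matching e M -> D \subset cover M ->
  (forall x y, [set x; y] \in M -> x \in D -> y \in D) -> ~~ odd #|D|.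
Proof.
move=> mM /setIidPr sD clD; rewrite -sD -cover_within.
  by rewrite (card_cover simple_e (matching_within D mM)) odd_double.
move=> f x fM xf xD; case/andP: (mM) => /subsetP/(_ _ fM) fE _.
have [y _ def_f] := edge_partner simple_e fE xf.
by rewrite def_f subUset !sub1set xD (clD x) // -def_f.
Qed.

Lemma cover_restrict M D : matching e M ->
  (forall x y, [set x; y] \in M -> x \in D -> y \in D) ->
  cover (within M D) = cover M :&: D.
Proof.
move=> mM clD; apply: cover_within => f x fM xf xD.
case/andP: (mM) => /subsetP/(_ _ fM) fE _.
have [y _ def_f] := edge_partner simple_e fE xf.
by rewrite def_f subUset !sub1set xD (clD x) // -def_f.
Qed.

Lemma cover_edge M x y : [set x; y] \in M -> (x \in cover M) * (y \in cover M).
Proof.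
by move=> xyM; split; apply/coverP; exists [set x; y]; rewrite ?inE ?eqxx ?orbT.
Qed.

Lemma factor_critical_odd S x : factor_critical e S -> x \in S -> odd #|S|.
Proof.
move=> fcS xS; have [M mM cM] := fcS x xS; rewrite (cardsD1 x) xS /= -cM.
by rewrite (card_cover simple_e mM) odd_double.
Qed.

(** Let [C] be the component of [x] and [y] a vertex outside it. The matching missing [x] makes |C|
    odd, the one missing [y] makes it even. *)
Lemma factor_critical_connected S : factor_critical e S ->
  {in S &, forall x y, connect (induced_rel e S) x y}.
Proof.
move=> fcS x y xS yS; apply/negPn/negP => nxy; set r := induced_rel e S in nxy.
pose C := [set z | connect r x z].
have clC z z' : z \in C -> r z z' -> z' \in C.
  by rewrite !inE => xz zz'; apply: connect_trans xz (connect1 zz').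
have CS : C \subset S.
  have clS : closed r (mem S) by move=> a b /and3P[aS bS _]; rewrite -[LHS]/(a \in S) -[RHS]/(b \in S) aS bS.
  by apply/subsetP => z; rewrite inE => /(closed_connect clS) <-.
have xC : x \in C by rewrite inE connect0.
have yC : y \notin C by rewrite inE.
have clM s M a b : matching e M -> cover M = S :\ s -> [set a; b] \in M ->
    a \in C -> b \in C /\ b != s.
  move=> mM cM abM aC; have [] := cover_edge abM; rewrite cM.
  move=> /setD1P[_ aS] /setD1P[bs bS]; split=> //; apply: clC aC _.
  by rewrite /r /induced_rel /= aS bS (matching_edge simple_e mM).
have [Mx mMx cMx] := fcS x xS; have [My mMy cMy] := fcS y yS.
have evD : ~~ odd #|C :\ x|.
  apply: (matching_even mMx) => [|a b abM]; first by rewrite cMx setSD.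
  by rewrite !inE => /andP[_ aC]; have [] := clM x Mx a b mMx cMx abM; rewrite ?inE // => -> ->.
have : ~~ odd #|C|.
  apply: (matching_even mMy) => [|a b abM aC]; last by have [] := clM y My a b.
  by rewrite cMy subsetD1 CS.
by rewrite (cardsD1 x) xC /= negbK (negbTE evD).
Qed.

(* If v separates S then S is the union of two sets meeting only in v; both are
   factor-critical and both of their constraints are tight where that of S is. *)
Lemma factor_critical_split S v : factor_critical e S ->
  cut_vertex S (induced_rel e S) v ->
  exists S', [/\ factor_critical e S', 2 < #|S'|, #|S'| < #|S|
               & forall M, matching e M -> near_perfect S M -> near_perfect S' M].
Proof.
set r := induced_rel e S => fcS [vS [x [y [xSv ySv xy_r nxy]]]].
set dl := del_vertex r v in nxy.
pose C1 := [set z | connect dl x z]; pose C2 := S :\ v :\: C1.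
have [/setD1P[nxv xS] /setD1P[nyv yS]] := (xSv, ySv).
have clSv : closed dl (mem (S :\ v)).
  move=> a b /and3P[/and3P[aS bS _] av bv].
  by rewrite -[LHS]/(a \in S :\ v) -[RHS]/(b \in S :\ v) !inE av bv aS bS.
have C1S z : z \in C1 -> z \in S :\ v.
  by rewrite inE => /(closed_connect clSv) <-.
have sym_dl : symmetric dl.
  by move=> a b; rewrite /dl /del_vertex /= [r a b]induced_sym [(a != v) && _]andbC.
have clC1 a b : a \in C1 -> b \in S :\ v -> e a b -> b \in C1.
  move=> aC1; have := C1S a aC1; rewrite !inE => /andP[av aS] /andP[bv bS] eab.
  move: aC1; rewrite inE => xa; apply: connect_trans xa (connect1 _).
  by rewrite /dl /del_vertex /r /induced_rel /= aS bS eab av bv.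
have clC2 a b : a \in C2 -> b \in S :\ v -> e a b -> b \in C2.
  rewrite inE => /andP[aC1 aSv] bSv eab; rewrite inE bSv andbT.
  by apply: contra aC1 => bC1; apply: clC1 bC1 aSv _; rewrite sym_e.
have vC1 : v \notin C1 by apply/negP => /C1S; rewrite !inE eqxx.
have xC1 : x \in C1 by rewrite inE connect0.
have yC2 : y \in C2 by rewrite inE ySv andbT inE.
have [Mv mMv cMv] := fcS v vS.
have edgeS M s a b : matching e M -> cover M = S :\ s -> [set a; b] \in M ->
    [/\ b \in S, b != s & e a b].
  move=> mM cM abM; have [_] := cover_edge abM; rewrite cM !inE => /andP[-> ->].
  by rewrite (matching_edge simple_e mM).
have clMv C : (forall a b, a \in C -> b \in S :\ v -> e a b -> b \in C) ->
    forall a b, [set a; b] \in Mv -> a \in C -> b \in C.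
  move=> clC a b abM aC; have [bS bv eab] := edgeS Mv v a b mMv cMv abM.
  by apply: clC aC _ eab; rewrite !inE bv.
have C1sub : C1 \subset S :\ v by apply/subsetP.
have C2sub : C2 \subset S :\ v by apply: subsetDl.
have ev1 : ~~ odd #|C1|.
  by apply: (matching_even mMv); [rewrite cMv | apply: clMv clC1].
have ev2 : ~~ odd #|C2|.
  by apply: (matching_even mMv); [rewrite cMv | apply: clMv clC2].
have cardS : #|S| = (#|C1| + #|C2|).+1.
  by rewrite (cardsD1 v) vS -(cardsID C1 (S :\ v)) (setIidPr C1sub).
have card1 : #|v |: C1| = #|C1|.+1 by rewrite cardsU1 vC1.
have vC2 : v \notin C2 by rewrite !inE eqxx andbF.
have card2 : #|v |: C2| = #|C2|.+1 by rewrite cardsU1 vC2.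
exists (v |: C1); split.
- move=> s /setU1P[->|sC1].
    exists (within Mv C1); first exact: matching_within.
    by rewrite (cover_restrict mMv (clMv _ clC1)) cMv (setIidPr C1sub) setU1K.
  have [nsv sS] := setD1P (C1S s sC1).
  have [M mM cM] := fcS s sS.
  have [z evz vzM] : exists2 z, e v z & [set v; z] \in M.
    by apply: (cover_partner simple_e mM); rewrite cM !inE eq_sym nsv.
  have [zS nzs _] := edgeS M s v z mM cM vzM.
  have nzv : z != v by rewrite eq_sym (edge_neq simple_e evz).
  (* If [v] were matched to [z] in [C2], the rest of [C2] would be matched within itself, although
     |C2| is even. *)
  have zC1 : z \in C1.
    apply: contraT => zC1; have zC2 : z \in C2 by rewrite inE zC1 !inE nzv zS.
    have : ~~ odd #|C2 :\ z|.
      apply: (matching_even mM) => [|a b abM].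
        apply/subsetP => a; rewrite cM !inE => /and4P[_ aC1 _ aS]; rewrite aS andbT.
        by apply: contraNneq aC1 => ->; move: sC1; rewrite inE.
      case/setD1P => naz aC2; have [bS nbs eab] := edgeS M s a b mM cM abM.
      have nbv : b != v.
        apply: contraNneq naz => bv; apply/eqP.
        by apply: (partner_uniq simple_e mM _ vzM); rewrite setUC -bv.
      apply/setD1P; split; last by apply: clC2 aC2 _ eab; rewrite !inE nbv.
      apply: contraNneq vC2 => bz; have <- // : a = v.
      by apply: (@partner_uniq _ _ simple_e M z); rewrite // setUC // -bz.
    move=> ev2'; move: ev2; rewrite (cardsD1 z) zC2 /= negbK.
    by rewrite (negbTE ev2').
  exists (within M (v |: C1)); first exact: matching_within.
  rewrite cover_restrict //.
    rewrite cM setIC setIDA; congr (_ :\ _); apply/setIidPl.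
    by rewrite subUset sub1set vS (subset_trans C1sub (subsetDl _ _)).
  move=> a b abM; have [bS nbs eab] := edgeS M s a b mM cM abM.
  case/setU1P => [av|aC1].
    have <- : z = b by apply: (partner_uniq simple_e mM vzM); rewrite -av.
    exact: setU1r.
  have [->|nbv] := eqVneq b v; first exact: setU11.
  by apply/setU1P; right; apply: clC1 aC1 _ eab; rewrite !inE nbv.
- rewrite card1; have : 0 < #|C1| by apply/card_gt0P; exists x.
  by move: ev1; case: #|C1| => [|[|n]].
- rewrite card1 cardS; have : 0 < #|C2| by apply/card_gt0P; exists y.
  by rewrite !ltnS -{1}[#|C1|]addn0 ltn_add2l.
move=> M mM; rewrite /near_perfect cardS card1 => npS.
(* Every edge inside [S] lies on one of the two sides, whose bounds |C1| / 2 and |C2| / 2 add up to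
   (|S| - 1) / 2. Equality for [S] thus forces equality on each side. *)
have sub : within M S \subset within M (v |: C1) :|: within M (v |: C2).
  apply/subsetP => f; rewrite !inE => /andP[fM fS]; rewrite fM /=.
  case/andP: (mM) => /subsetP/(_ _ fM)/edge_setP[a [b [eab def_f]]] _.
  have [aS bS] : a \in S /\ b \in S.
    by split; apply: (subsetP fS); rewrite def_f !inE eqxx ?orbT.
  have C12 z : z \in S -> z != v -> (z \in C1) || (z \in C2).
    by move=> zS zv; rewrite [z \in C2]inE !inE zv zS; case: connect.
  have UC1 z : z \in C1 -> z \in v |: C1 by apply: setU1r.
  have UC2 z : z \in C2 -> z \in v |: C2 by apply: setU1r.
  rewrite def_f !subUset !sub1set.
  have [->|nav] := eqVneq a v.
    rewrite !setU11 /=; have [->|nbv] := eqVneq b v; first by rewrite setU11.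
    by case/orP: (C12 b bS nbv) => [/UC1|/UC2] ->; rewrite ?orbT.
  have [->|nbv] := eqVneq b v.
    rewrite !setU11 !andbT; by case/orP: (C12 a aS nav) => [/UC1|/UC2] ->; rewrite ?orbT.
  have bSv : b \in S :\ v by rewrite !inE nbv.
  case/orP: (C12 a aS nav) => aC.
    by rewrite (UC1 a aC) (UC1 b (clC1 a b aC bSv eab)).
  by rewrite (UC2 a aC) (UC2 b (clC2 a b aC bSv eab)) orbT.
have o1 : odd #|v |: C1| by rewrite card1.
have o2 : odd #|v |: C2| by rewrite card2.
have := within_card_odd simple_e mM o1; have := within_card_odd simple_e mM o2.
have := subset_leq_card sub; have := (leq_card_setU (within M (v |: C1)) (within M (v |: C2))).1.
rewrite card1 card2; move: npS; clear; lia.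
Qed.

(** Pieces are split off at cut vertices and shrink strictly. [P] stands for being an optimum for a
    fixed weight, and tightness is inherited at each split. *)
Lemma factor_critical_nonseparable (P : {set {set T}} -> Prop) S :
  (forall M, P M -> matching e M) ->
  factor_critical e S -> 2 < #|S| -> (forall M, P M -> near_perfect S M) ->
  exists S', [/\ factor_critical e S', 2 < #|S'|, nonseparable e S' (induced_rel e S')
               & forall M, P M -> near_perfect S' M].
Proof.
move=> mP; have [n] := ubnP #|S|; elim: n S => // n IHn S ltS fcS gtS npS.
case: (pselect (exists v, cut_vertex S (induced_rel e S) v)) => [[v cv]|ncv]; last first.
  exists S; split=> //; split; last by move=> v cv; apply: ncv; exists v.
  split; first exact: induced_subgraph; last exact: factor_critical_connected.
  by rewrite -card_gt0; apply: leq_trans gtS.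
have [S' [fcS' gtS' ltS' npS']] := factor_critical_split fcS cv.
apply: (IHn S') => //; first by apply: leq_trans ltS' _; rewrite -ltnS.
by move=> M PM; apply: npS' (mP M PM) (npS M PM).
Qed.

Lemma triangle_factor_critical x y z : e x y -> e x z -> e y z ->
  factor_critical e [set x; y; z].
Proof.
move=> exy exz eyz.
have [[nxy nxz] nyz] := (edge_neq simple_e exy, edge_neq simple_e exz, edge_neq simple_e eyz).
move=> s; rewrite !inE -orbA => /or3P[]/eqP ->.
- exists [set [set y; z]]; first by rewrite matching_set1 ?mem_edge_set.
  rewrite cover_set1; apply/setP => a; rewrite !inE; case: (eqVneq a x) => //= ->.
  by rewrite (negbTE nxy) (negbTE nxz).
- exists [set [set x; z]]; first by rewrite matching_set1 ?mem_edge_set.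
  rewrite cover_set1; apply/setP => a; rewrite !inE; case: (eqVneq a y) => //= [->|_].
    by rewrite eq_sym (negbTE nxy) (negbTE nyz).
  by rewrite orbF.
- exists [set [set x; y]]; first by rewrite matching_set1 ?mem_edge_set.
  rewrite cover_set1; apply/setP => a; rewrite !inE; case: (eqVneq a z) => //= [->|_].
    by rewrite ![z == _]eq_sym (negbTE nxz) (negbTE nyz).
  by rewrite orbF.
Qed.

(* Every face of the matching polytope lies in the facet of an edge, of an
   essential vertex, or of a nonseparable factor-critical set. *)
Lemma tight_constraint (R : realFieldType) (W : {set T} -> R) :
  (exists2 f, f \in edge_set e & W f != 0%R) ->
  [\/ exists2 f, f \in edge_set e & forall M, max_weight e W M -> f \notin M,
      exists2 v, essential e v & forall M, max_weight e W M -> v \in cover M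
    | exists S, [/\ factor_critical e S, 2 < #|S|, nonseparable e S (induced_rel e S)
                  & forall M, max_weight e W M -> near_perfect S M]].
Proof.
move=> W_neq0.
case: (pselect (exists2 f, f \in edge_set e & forall M, max_weight e W M -> f \notin M)).
  by move=> case1; apply: Or31.
move=> ncase1.
have odd_case S : factor_critical e S -> 2 < #|S| ->
    (forall M, max_weight e W M -> near_perfect S M) ->
  [\/ exists2 f, f \in edge_set e & forall M, max_weight e W M -> f \notin M,
      exists2 v, essential e v & forall M, max_weight e W M -> v \in cover M
    | exists S, [/\ factor_critical e S, 2 < #|S|, nonseparable e S (induced_rel e S)
                  & forall M, max_weight e W M -> near_perfect S M]].
  by move=> fcS gtS npS; apply: Or33; apply: factor_critical_nonseparable npS => // M [].
case: (pselect (exists v, forall M, max_weight e W M -> v \in cover M)); last first.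
  move=> ncase2.
  have used f : f \in edge_set e -> exists2 M, max_weight e W M & f \in M.
    move=> fE; apply: contrapT => nf; apply: ncase1; exists f => // M maxM.
    by apply/negP => fM; apply: nf; exists M.
  have missed v : exists2 M, max_weight e W M & v \notin cover M.
    apply: contrapT => nv; apply: ncase2; exists v => M maxM.
    by apply: contraT => vM; case: nv; exists M.
  have [S [fcS gtS npS]] := max_weight_near_perfect simple_e used missed W_neq0.
  exact: odd_case npS.
case=> v covv; case: (pselect (essential e v)) => [essv|ness].
  by apply: Or32; exists v.
have [M0 maxM0] := max_weight_exists e W.
have mate_v M : max_weight e W M -> exists2 u, e v u & [set v; u] \in M.
  by move=> maxM; apply: (cover_partner simple_e maxM.1) (covv M maxM).
have [u evu _] := mate_v M0 maxM0.
have : 0 < degree e v by apply/card_gt0P; exists u; rewrite inE.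
case deg_v: (degree e v) => [|[|[|d]]] // _.
(* A leaf [v] that is not essential has a neighbour [u] of degree at least 2. Covering [v] uses the
   edge uv, so [u] is always covered too; and [u] is essential, since [v] is adjacent to no other
   neighbour of [u]. *)
- have /eqP/cards1P[u' Nv] := deg_v.
  have Nvu w : e v w -> w = u.
    have inN z : e v z = (z == u') by have /setP/(_ z) := Nv; rewrite !inE.
    by move: evu; rewrite !inN => /eqP -> /eqP ->.
  have deg_u : degree e u != 1.
    apply/eqP => deg_u; apply: ness; apply: Or31; split=> // w /Nvu ->//.
  apply: Or32; exists u => [|M maxM]; last first.
    by have [w /Nvu -> vuM] := mate_v M maxM; have [] := cover_edge vuM.
  have : 0 < degree e u by apply/card_gt0P; exists v; rewrite inE sym_e.
  case deg_u': (degree e u) deg_u => [|[|[|d]]] // _ _; last by apply: Or33; rewrite deg_u'.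
  apply: Or32; split=> // a b eua eub nab; apply/negP => eab.
  have : #|[set v; a; b]| <= degree e u.
    apply/subset_leq_card/subsetP => w; rewrite !inE -orbA => /or3P[]/eqP -> //.
    by rewrite sym_e.
  rewrite deg_u' -setUA cardsU1 !inE cards2 nab negb_or.
  have -> : v != a.
    by apply/eqP => va; subst; move/Nvu: eab eub => ->; rewrite simple_e.2.
  have -> // : v != b.
  by apply/eqP => vb; subst; move: eab eua; rewrite sym_e => /Nvu ->; rewrite simple_e.2.
(* A vertex [v] of degree 2 that is not essential lies in a triangle with its neighbours. The edge
   covering [v] is inside this triangle, which is all that tightness of a 3-set requires. *)
- have : ~ forall a b, e v a -> e v b -> a != b -> ~~ e a b.
    by move=> nadj; apply: ness; apply: Or32.
  move=> /existsNP[a /existsNP[b /not_implyP[eva /not_implyP[evb /not_implyP[nab /negP]]]]].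
  rewrite negbK => eab; apply: (odd_case [set v; a; b]).
  + exact: triangle_factor_critical.
  + by rewrite -setUA cardsU1 !inE cards2 nab negb_or !(edge_neq simple_e).
  have Nv : [set w | e v w] = [set a; b].
    apply/esym/eqP; rewrite eqEcard cards2 nab -[#|[set w | _]|]/(degree e v) deg_v andbT.
    by apply/subsetP => w; rewrite !inE => /orP[]/eqP ->.
  move=> M maxM; have [w evw vwM] := mate_v M maxM.
  have c3 : #|[set v; a; b]| = 3.
    by rewrite -setUA cardsU1 !inE cards2 nab negb_or !(edge_neq simple_e).
  have := within_card_odd simple_e (D := [set v; a; b]) maxM.1; rewrite /near_perfect c3.
  move/(_ isT); have : 0 < #|within M [set v; a; b]|.
    apply/card_gt0P; exists [set v; w]; rewrite inE vwM subUset !sub1set !inE eqxx /=.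
    have : w \in [set w' | e v w'] by rewrite inE.
    by rewrite Nv !inE -orbA => ->; rewrite orbT.
  by case: #|_| => [|[|n]].
- by case: ness; apply: Or33; rewrite deg_v.
Qed.

End FactorCritical.

(** * Facets from odd cycles and essential vertices *)

Section OddCycles.
Variables (T : finType) (e : rel T).
Hypothesis simple_e : simple_graph e.
Implicit Types (x y z : T) (M : {set {set T}}) (S : {set T}) (s l p q : seq T).

Let sym_e : symmetric e := simple_e.1.

Definition odd_cycle s : bool := [&& cycle e s, uniq s & odd (size s)].

Lemma odd_cycle_rot i s : odd_cycle (rot i s) = odd_cycle s.
Proof. by rewrite /odd_cycle rot_cycle rot_uniq size_rot. Qed.

Lemma odd_cycle_size s : odd_cycle s -> 2 < size s.
Proof.
case: s => [|x [|y [|z s]]] //= /and3P[] //=; by rewrite /= simple_e.2.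
Qed.

Lemma near_perfect_pairs S l : adjacent_pairs e l -> uniq l -> {subset l <= S} ->
  #|S| = (size l).+1 -> near_perfect S (pairs l).
Proof.
move=> al ul lS cS; have := card_cover simple_e (matching_pairs simple_e al ul).
rewrite (cover_pairs al) cardsE (card_uniqP ul) /near_perfect cS => ->.
congr (_.*2.+1); apply: eq_card => f; rewrite inE; case fl: (f \in pairs l) => //=.
apply/subsetP => x xf; apply: lS; have : x \in cover (pairs l) by apply/coverP; exists f.
by rewrite (cover_pairs al) inE.
Qed.

Lemma near_perfect_pairs2 S a b l : adjacent_pairs e l -> uniq l -> {subset l <= S} ->
  #|S| = (size l).+1 -> ~~ ([set a; b] \subset S) -> near_perfect S (pairs [:: a, b & l]).
Proof.
move=> al ul lS cS abS; rewrite /near_perfect -(near_perfect_pairs al ul lS cS); congr (_.*2.+1).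
apply: eq_card => f; rewrite !inE; case: eqP => //= ->.
by rewrite (negbTE abS) !andbF.
Qed.

Section Constant.
Local Open Scope ring_scope.
Variables (V : zmodType) (W : {set T} -> V) (c : V) (S : {set T}).
Hypothesis const_W : forall M, matching e M -> near_perfect S M -> \sum_(f in M) W f = c.

(** Rotation invariance makes this the common weight of all edges of the cycle. The value 0 is never
    met there, as an odd cycle has at least three vertices. *)
Definition first_edge s : V := if s is x :: y :: _ then W [set x; y] else 0.

Lemma odd_cycle_set s : odd_cycle s -> S = [set x in s] -> #|S| = size s.
Proof. by case/and3P => _ us _ ->; rewrite cardsE; apply/card_uniqP. Qed.

Lemma pairs_exchange x y x' y' l :
  adjacent_pairs e [:: x, y & l] -> uniq [:: x, y & l] ->
  adjacent_pairs e [:: x', y' & l] -> uniq [:: x', y' & l] ->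
  near_perfect S (pairs [:: x, y & l]) -> near_perfect S (pairs [:: x', y' & l]) ->
  W [set x; y] = W [set x'; y'].
Proof.
move=> a1 u1 a2 u2 n1 n2.
have := const_W (matching_pairs simple_e a1 u1) n1.
rewrite -(const_W (matching_pairs simple_e a2 u2) n2) !(sum_pairs (e := e)) //.
exact: addIr.
Qed.

(** The consecutive edges xy and yz are completed by the same pairing of the remaining even path;
    the first matching misses [z], the second misses [x]. *)
Lemma first_edge_rot1 s : odd_cycle s -> S = [set x in s] ->
  first_edge (rot 1 s) = first_edge s.
Proof.
move=> os defS; have gt2 := odd_cycle_size os; have cS := odd_cycle_set os defS.
case: s os defS gt2 cS => [|x [|y [|z s]]] //= os defS _ cS.
have /and3P[/= /and3P[exy eyz pz] us o_s] := os.
move: us; rewrite !inE !negb_or -!andbA => /and4P[nxy nxz xs /and4P[nyz ys zs us]].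
have ps : adjacent_pairs e s.
  move: pz; rewrite rcons_path => /andP[pz _].
  by apply: (path_pairs pz); rewrite -[odd _]negbK.
have sS w : w \in [:: x, y, z & s] -> w \in S by rewrite {}defS in_set.
apply/esym/(@pairs_exchange _ _ _ _ s).
- by rewrite /= exy.
- by rewrite /= inE negb_or nxy xs ys.
- by rewrite /= eyz.
- by rewrite /= inE negb_or nyz ys zs.
- apply: near_perfect_pairs => //=; first by rewrite exy.
  + by rewrite inE negb_or nxy xs ys.
  + by move=> w; rewrite !inE => ws; apply: sS; rewrite !inE; case/or3P: ws => ->; rewrite ?orbT.
apply: near_perfect_pairs => //=; first by rewrite eyz.
  by rewrite inE negb_or nyz ys zs.
by move=> w ws; apply: sS; rewrite inE ws orbT.
Qed.

Lemma first_edge_rot i s : odd_cycle s -> S = [set x in s] ->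
  first_edge (rot i s) = first_edge s.
Proof.
move=> os defS; elim: i => [|i IHi]; first by rewrite rot0.
case: (ltnP i (size s)) => [lt_i|le_i]; last by rewrite rot_oversize // ltnW.
rewrite rotS // first_edge_rot1 ?odd_cycle_rot //.
by rewrite defS; apply/setP => x; rewrite !inE mem_rot.
Qed.

(** Let [z] follow [x] on the cycle. The chord xy and the cycle edge xz are completed by the same
    pairs: after [z] is removed, the arc from [x] to [y] is even, and by parity so is the other
    arc. *)
Lemma chord_edge x p y q : odd_cycle (x :: p ++ y :: q) ->
  S = [set z in x :: p ++ y :: q] -> e x y -> odd (size p) ->
  W [set x; y] = first_edge (x :: p ++ y :: q).
Proof.
case: p => [|z p] // os defS exy op.
have cS := odd_cycle_set os defS.
have /and3P[/= /andP[exz pc] us o_s] := os.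
rewrite size_cat /= negbK in o_s op *; rewrite /= in us.
have perm_u : perm_eq [:: x, z & p ++ y :: q] [:: x, z, y & p ++ q].
  by rewrite !perm_cons; apply: (permEl (perm_catCA p [:: y] q)).
have us' : uniq [:: x, z, y & p ++ q] by rewrite -(perm_uniq perm_u).
move: us'; rewrite /= !inE !negb_or -!andbA => /and4P[nxz nxy xpq /and4P[nzy zpq ypq upq]].
have apq : adjacent_pairs e (p ++ q).
  rewrite adjacent_pairs_cat //; move: pc.
  rewrite rcons_cat cat_path /= rcons_path => /and4P[pp _ pq _].
  rewrite (path_pairs pp) //= (path_pairs pq) //.
  by move: o_s op; rewrite addnS /= oddD; case: (odd (size p)); case: odd.
have sS w : w \in [:: x, z, y & p ++ q] -> w \in S.
  by rewrite defS in_set (perm_mem perm_u).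
have szS : #|S| = (size (p ++ q)).+3.
  by rewrite cS /= !size_cat /= addnS.
rewrite /=; apply: (@pairs_exchange _ _ _ _ (p ++ q)).
- by rewrite /= exy.
- by rewrite /= inE negb_or nxy xpq ypq.
- by rewrite /= exz.
- by rewrite /= inE negb_or nxz xpq zpq.
- apply: near_perfect_pairs => //=; first by rewrite exy.
    by rewrite inE negb_or nxy xpq ypq.
  by move=> w ws; apply: sS; move: ws; rewrite !inE => /or3P[]->; rewrite ?orbT.
- apply: near_perfect_pairs => //=; first by rewrite exz.
    by rewrite inE negb_or nxz xpq zpq.
  by move=> w ws; apply: sS; move: ws; rewrite !inE => /or3P[]->; rewrite ?orbT.
Qed.

(* An edge outside S extends a near-perfect matching of S, and a chord splits
   the cycle into an odd and an even part, so can be exchanged with an edge of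
   the cycle. *)
Lemma odd_cycle_const s : odd_cycle s -> S = [set x in s] ->
  forall f, f \in edge_set e -> W f = if f \subset S then first_edge s else 0.
Proof.
move=> os defS _ /edge_setP[a [b [eab ->]]]; case: ifP => [|/negbT abS].
  rewrite subUset !sub1set => /andP[aS bS].
  have a_s : a \in s by move: aS; rewrite defS inE.
  have [i t def_s] := rot_to a_s.
  have : b \in rot i s by rewrite mem_rot; move: bS; rewrite defS inE.
  have ot : odd_cycle (rot i s) by rewrite odd_cycle_rot.
  have defS' : S = [set x in rot i s] by rewrite defS; apply/setP => x; rewrite !inE mem_rot.
  rewrite -(first_edge_rot i os defS) def_s in ot defS' *.
  rewrite inE eq_sym (negbTE (edge_neq simple_e eab)) orFb => bt.
  case/splitPr: bt ot defS' {def_s} => p q ot defS'.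
  have [op|ep] := boolP (odd (size p)); first exact: chord_edge.
  (* If the arc from [a] to [b] is even then the other one is odd, so the chord is read from [b]. *)
  have rot_pq : rot (size p).+1 (a :: p ++ b :: q) = b :: q ++ a :: p.
    by rewrite -cat_cons -[(size p).+1]/(size (a :: p)) rot_size_cat.
  rewrite -(first_edge_rot (size p).+1 ot defS') rot_pq setUC; apply: chord_edge.
  - by rewrite -rot_pq odd_cycle_rot.
  - by rewrite -rot_pq defS'; apply/setP => x; rewrite !inE mem_rot !inE.
  - by rewrite sym_e.
  - case/and3P: ot => _ _; rewrite /= size_cat /= addnS /= oddD (negbTE ep) /=.
    by rewrite negbK.
have abS' := abS.
(* An edge not inside [S] has at most one end on the cycle. With [z] that end, or any vertex of the
   cycle if there is none, the rest of the cycle is an even path disjoint from the edge. *)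
have [z zs zab] : exists2 z, z \in s & forall w, w \in S -> w \in [set a; b] -> w = z.
  have in_s w : w \in S -> w \in s by rewrite defS inE.
  have [x xs] : exists x, x \in s by case: (s) (odd_cycle_size os) => // x; exists x; rewrite inE eqxx.
  rewrite subUset !sub1set negb_and in abS.
  have [aS|aS] := boolP (a \in S).
    by exists a; rewrite ?in_s // => w wS; rewrite !inE => /orP[]/eqP // wb; rewrite -wb wS aS in abS.
  have [bS|bS] := boolP (b \in S).
    by exists b; rewrite ?in_s // => w wS; rewrite !inE => /orP[]/eqP // wa; rewrite -wa wS in aS.
  by exists x => // w wS; rewrite !inE => /orP[]/eqP wa; [rewrite -wa wS in aS | rewrite -wa wS in bS].
have [i t def_s] := rot_to zs.
have ot : odd_cycle (z :: t) by rewrite -def_s odd_cycle_rot.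
have defS' : S = [set x in z :: t].
  by rewrite defS -def_s; apply/setP => x; rewrite !inE mem_rot.
have /and3P[/= pt /andP[zt ut] o_t] := ot.
have at_ : adjacent_pairs e t.
  by move: pt; rewrite rcons_path => /andP[pt _]; apply: path_pairs pt o_t.
have tS : {subset t <= S} by move=> w wt; rewrite defS' !inE wt orbT.
have cS : #|S| = (size t).+1 by rewrite (odd_cycle_set ot defS').
have nt w : w \in [set a; b] -> w \notin t.
  by move=> wab; apply: contraNN zt => wt; rewrite -(zab w (tS w wt) wab).
have aabt : adjacent_pairs e [:: a, b & t] by rewrite /= eab.
have uabt : uniq [:: a, b & t].
  by rewrite /= inE negb_or (edge_neq simple_e eab) !nt ?inE ?eqxx ?orbT.
have := const_W (matching_pairs simple_e aabt uabt) (near_perfect_pairs2 at_ ut tS cS abS').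
rewrite (sum_pairs (e := e)) // (const_W (matching_pairs simple_e at_ ut)).
  by move/(canRL (addrK c)); rewrite subrr.
exact: near_perfect_pairs.
Qed.

End Constant.

Lemma odd_cycle_near_perfect s : odd_cycle s ->
  exists2 M, matching e M & near_perfect [set x in s] M.
Proof.
case: s => // x l; case/and3P => /= pl /andP[xl ul] ol.
have al : adjacent_pairs e l.
  by move: pl; rewrite rcons_path => /andP[pl _]; apply: path_pairs pl ol.
exists (pairs l); first exact: matching_pairs.
apply: near_perfect_pairs => // [y yl|]; first by rewrite !inE yl orbT.
rewrite cardsE; apply/card_uniqP; by rewrite /= xl.
Qed.

End OddCycles.

(** * The constraint at an essential vertex *)

Section EssentialVertex.
Variables (T : finType) (e : rel T).
Hypothesis simple_e : simple_graph e.

Implicit Types (v : T) (S : {set T}) (m : {set {set T}}) (p : pred {set T}).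

Let sym_e : symmetric e := simple_e.1.

Definition select (m : {set {set T}}) (p : pred {set T}) : {set {set T}} :=
  [set f in m | p f].

Lemma in_select m p f : (f \in select m p) = (f \in m) && p f.
Proof. by rewrite inE. Qed.

Lemma select0 p : select set0 p = set0.
Proof. by apply/setP => f; rewrite !inE. Qed.

Lemma sum_indicator (R : pzSemiRingType) m (p : pred {set T}) :
  (\sum_(f in m) (p f)%:R = #|select m p|%:R :> R)%R.
Proof.
rewrite -sum1dep_card natr_sum big_mkcondr; apply: eq_bigr => f _.
by case: (p f).
Qed.

Lemma matching_degree_le m v : matching e m -> #|select m (fun f => v \in f)| <= 1.
Proof.
move=> mm; apply/card_le1_eqP => f g; rewrite !in_select => /andP[fm vf] /andP[gm vg].
exact: (matching_disj mm gm fm vg vf).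
Qed.

Lemma matching_degree1 m v : matching e m ->
  (#|select m (fun f => v \in f)| == 1) = (v \in cover m).
Proof.
move=> mm; rewrite eqn_leq matching_degree_le //=.
apply/card_gt0P/coverP => [[f]|[f fm vf]]; last by exists f; rewrite in_select fm.
by rewrite in_select => /andP[fm vf]; exists f.
Qed.

Lemma near_perfect_half m S : odd #|S| ->
  near_perfect S m <-> #|select m (fun f => f \subset S)| = (#|S|)./2.
Proof.
rewrite /near_perfect -[within m S]/(select m (fun f => f \subset S)) => oS.
by have := odd_double_half #|S|; rewrite oS; split; lia.
Qed.

Lemma matching_select_le m S : odd #|S| -> matching e m ->
  #|select m (fun f => f \subset S)| <= (#|S|)./2.
Proof.
move=> oS mm; have := within_card_odd simple_e mm oS.
rewrite -[within m S]/(select m (fun f => f \subset S)).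
by have := odd_double_half #|S|; rewrite oS; lia.
Qed.

Lemma essential_neighbor v : essential e v -> exists u, e v u.
Proof.
move=> ess; have /card_gt0P[u] : 0 < degree e v by case: ess => [[->]|[->]|/ltnW/ltnW].
by rewrite inE; exists u.
Qed.

(** Otherwise all neighbours of [v] are among the adjacent [x] and [y]. If there is one, it has
    degree at least 2; if there are two, they are adjacent; there are never three. Each clause of
    [essential] is thus excluded. *)
Lemma essential_avoid v x y : essential e v -> e x y -> v != x -> v != y ->
  exists u, [/\ e v u, u != x & u != y].
Proof.
move=> ess exy nvx nvy; apply: contrapT => none.
have sub : [set w | e v w] \subset [set x; y].
  apply/subsetP => w; rewrite !inE => evw; apply: contraT; rewrite negb_or => /andP[nwx nwy].
  by case: none; exists w.
have c2 : #|[set x; y]| = 2 by rewrite cards2 (edge_neq simple_e).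
case: ess => [[deg1 deg_w]|[deg2 nadj]|deg3].
- have [u evu] : exists u, e v u by apply: essential_neighbor; apply: Or31.
  have other z : e u z -> v = z.
    move=> euz; have /eqP/cards1P[w Nu] := deg_w u evu.
    have : v \in [set w' | e u w'] by rewrite inE sym_e.
    have : z \in [set w' | e u w'] by rewrite inE.
    by rewrite Nu !inE => /eqP -> /eqP.
  have : u \in [set x; y] by apply: (subsetP sub); rewrite inE.
  rewrite !inE => /orP[]/eqP uE; subst u.
    by move/other: exy nvy => ->; rewrite eqxx.
  by move: exy nvx; rewrite sym_e => /other ->; rewrite eqxx.
- have eqN : [set w | e v w] = [set x; y].
    by apply/eqP; rewrite eqEcard sub c2 -[#|[set w | _]|]/(degree e v) deg2.
  have evx : e v x by have := set21 x y; rewrite -eqN inE.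
  have evy : e v y by have := set22 x y; rewrite -eqN inE.
  by have := nadj x y evx evy (edge_neq simple_e exy); rewrite exy.
by have := leq_trans deg3 (subset_leq_card sub); rewrite c2.
Qed.

(** An edge at [v] alone is a matching of sum [c]. An edge avoiding [v] can be added to some edge at
    [v] without changing the sum, so it has weight 0. *)
Lemma essential_const (V : zmodType) (W : {set T} -> V) (c : V) v : essential e v ->
  (forall M, matching e M -> v \in cover M -> (\sum_(f in M) W f = c)%R) ->
  forall f, f \in edge_set e -> W f = if v \in f then c else 0%R.
Proof.
move=> ess const_W f fE; case: ifP => vf.
  by rewrite -(const_W [set f]) ?matching_set1 ?cover_set1 // big_set1.
have [x [y [exy def_f]]] := edge_setP _ _ fE.
move: vf; rewrite def_f !inE => /norP[nvx nvy].
have [u [evu nux nuy]] := essential_avoid ess exy nvx nvy.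
have vuE : [set v; u] \in edge_set e by rewrite mem_edge_set.
have vf : v \notin f by rewrite def_f !inE negb_or nvx.
have mM : matching e ([set v; u] |: [set f]).
  apply: matching_add => //; rewrite ?matching_set1 ?cover_set1 //.
  by rewrite def_f !inE negb_or nux.
have := const_W _ mM; rewrite coverU1 !inE eqxx => /(_ isT).
rewrite big_setU1 /=; last by rewrite inE; apply: contraNneq vf => <-; rewrite !inE eqxx.
rewrite big_set1 -(const_W [set [set v; u]]) ?matching_set1 ?cover_set1 ?set21 // big_set1.
by rewrite -def_f => /eqP; rewrite -subr_eq0 addrAC subrr add0r => /eqP.
Qed.

End EssentialVertex.

(** * Shortest odd cycles and ears *)

Section OddWalks.
Variables (T : finType) (r : rel T).
Hypothesis sym_r : symmetric r.
Implicit Types (x y z : T) (s p q : seq T).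

(** The bipartite double cover: each step flips the bit, so a path from (y, false) to (y, true)
    projects to a closed walk of odd length through [y]. *)
Definition double_cover : rel (T * bool) := [rel u v | r u.1 v.1 && (u.2 != v.2)].

Lemma double_cover_sym : symmetric double_cover.
Proof. by move=> u v; rewrite /double_cover /= sym_r eq_sym. Qed.

Lemma double_cover_path u (p : seq (T * bool)) : path double_cover u p ->
  path r u.1 (map fst p) /\ (last u p).2 = u.2 (+) odd (size p).
Proof.
elim: p u => [|v p IHp] u /=; first by rewrite addbF.
case/andP => /andP[ruv nuv] /IHp[-> ->]; rewrite ruv; split=> //.
by move: nuv; case: u.2; case: v.2; case: odd.
Qed.

Lemma double_cover_lift x a p : path r x p ->
  connect double_cover (x, a) (last x p, a (+) odd (size p)).
Proof.
elim: p x a => [|y p IHp] x a /=; first by rewrite addbF.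
case/andP => rxy /(IHp _ (~~ a)) yp; apply: connect_trans (connect1 _) _; last first.
  by move: yp; rewrite addNb -addbN; apply.
by rewrite /double_cover /= rxy; case: a {yp}.
Qed.

(** The side [A] consists of the vertices that an even walk joins to the root of their component. An
    edge within [A] closes an odd walk, and a vertex outside [A] is joined to the root by an odd
    walk, which puts its neighbours into [A]. *)
Lemma bipartite_or_odd_walk :
  bipartite r \/ exists2 s, cycle r s & odd (size s).
Proof.
have csym := sym_connect_sym double_cover_sym.
have walk y : connect double_cover (y, false) (y, true) ->
    exists2 s, cycle r s & odd (size s).
  case/connectP => p /double_cover_path[/= pp op] lp.
  rewrite -lp /= in op; have : last y (map fst p) = y.
    by rewrite -[y in LHS]/(y, false).1 last_map -lp.
  case/lastP: {lp} p pp op => [|p u] //; rewrite map_rcons last_rcons => pp op uy.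
  exists (y :: map fst p); first by rewrite /= -{2}uy.
  by rewrite /= size_map; move: op; rewrite size_rcons.
pose A := [set x | connect double_cover (fingraph.root r x, false) (x, false)].
have [/forallP bip|] := boolP [forall x, forall y, r x y ==> ((x \in A) != (y \in A))].
  by left; exists A => x y rxy; move/forallP/(_ y)/implyP: (bip x); apply.
case/forallPn => x /forallPn[y]; rewrite negb_imply => /andP[rxy]; rewrite negbK => /eqP xyA.
right; have rootxy : fingraph.root r x = fingraph.root r y.
  by apply/(fingraph.rootP (sym_connect_sym sym_r)); apply: connect1.
have dxy a : connect double_cover (x, a) (y, ~~ a).
  by apply: connect1; rewrite /double_cover /= rxy; case: a.
have [xA|nxA] := boolP (x \in A).
  apply: (walk y); have yA : y \in A by rewrite -xyA.
  rewrite inE in yA; rewrite csym; apply: connect_trans yA; rewrite csym.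
  by rewrite inE rootxy in xA; apply: connect_trans xA (dxy false).
case/negP: nxA; rewrite xyA inE.
have /connectP[p pp def_x] := connect_root r x.
move: (double_cover_lift false pp); rewrite -def_x csym => rx.
have [op|ep] := boolP (odd (size p)).
  rewrite op /= csym in rx.
  have := double_cover_lift true pp; rewrite -def_x op /= csym => rx'.
  by rewrite -rootxy; apply: connect_trans rx' (dxy true).
rewrite (negbTE ep) /= in rx; have : x \in A by rewrite inE.
by rewrite xyA inE.
Qed.

(** Minimality ranges over all odd closed walks, repetitions allowed, so shorter competitors can be
    glued together freely; distinctness of the vertices is then a consequence. *)
Definition shortest_odd_cycle s : Prop :=
  [/\ cycle r s, odd (size s) &
      forall s', cycle r s' -> odd (size s') -> size s <= size s'].

Lemma shortest_odd_cycle_exists :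
  (exists2 s, cycle r s & odd (size s)) -> exists s, shortest_odd_cycle s.
Proof.
case=> s0 cs0 os0.
pose P n := [exists t : n.-tuple T, cycle r t && odd n].
have exP : exists n, P n.
  by exists (size s0); apply/existsP; exists (in_tuple s0); rewrite cs0.
case: (ex_minnP exP) => n /existsP[t /andP[ct on]] minn.
exists t; split; rewrite ?size_tuple // => s' cs' os'.
by apply: minn; apply/existsP; exists (in_tuple s'); rewrite cs'.
Qed.

Lemma not_uniq_split s : ~~ uniq s -> exists x s1 s2 s3, s = s1 ++ x :: s2 ++ x :: s3.
Proof.
elim: s => //= x s IHs; rewrite negb_and negbK; have [xs _|_ /= /IHs] := boolP (x \in s).
  by case/splitPr: xs => p q; exists x, [::], p, q.
by case=> y [s1 [s2 [s3 ->]]]; exists y, (x :: s1), s2, s3.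
Qed.

(** A repeated vertex splits the walk into two shorter closed walks, one of which is odd. *)
Lemma shortest_odd_cycle_uniq s : shortest_odd_cycle s -> uniq s.
Proof.
case=> cs os mins; apply/negPn/negP => /not_uniq_split[x [s1 [s2 [s3 def_s]]]].
have def_rot : rot (size s1) s = x :: s2 ++ x :: (s3 ++ s1).
  by rewrite def_s rot_size_cat /= -catA.
have : cycle r (x :: s2 ++ x :: (s3 ++ s1)) by rewrite -def_rot rot_cycle.
have : odd (size (x :: s2 ++ x :: (s3 ++ s1))) by rewrite -def_rot size_rot.
have size_s : size s = size (x :: s2 ++ x :: (s3 ++ s1)) by rewrite -def_rot size_rot.
have -> : cycle r (x :: s2 ++ x :: (s3 ++ s1)) = cycle r (x :: s2) && cycle r (x :: (s3 ++ s1)).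
  by rewrite [LHS]/= rcons_cat /= -cat_rcons cat_path last_rcons.
move=> os' /andP[c2 c3].
have := mins _ c2; have := mins _ c3; move: os' {def_rot mins cs os def_s c2 c3}.
rewrite size_s; move: (s3 ++ s1) => t; rewrite /= size_cat /= addnS /= negbK oddD.
case: (odd (size s2)) => /=; first by move/negbTE => -> /(_ isT) le_t _; lia.
by move=> _ _ /(_ isT); lia.
Qed.

(** The edge xy closes each arc to a walk, of lengths |p| + 2 and |q| + 2. Exactly one of these is
    odd, and it is no shorter than [s] only if the opposite arc is empty. *)
Lemma shortest_odd_cycle_chord i s x p y q : shortest_odd_cycle s ->
  rot i s = x :: p ++ y :: q -> r x y -> p = [::] \/ q = [::].
Proof.
case=> cs os mins def_s rxy.
have : cycle r (x :: p ++ y :: q) by rewrite -def_s rot_cycle.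
have size_s : size s = (size p + size q).+2 by rewrite -(size_rot i) def_s /= size_cat /= addnS.
rewrite /= rcons_cat cat_path /= => /and3P[pp rpy pq].
have [op|ep] := boolP (odd (size p)).
  right; have := mins (x :: rcons p y); rewrite /= !rcons_path pp rpy last_rcons sym_r rxy.
  rewrite size_rcons /= negbK op size_s => /(_ isT isT); case: q {def_s size_s pq} => //= z q; lia.
left; have := mins (y :: rcons q x); rewrite /= rcons_path pq last_rcons rxy.
rewrite size_rcons /= negbK size_s.
have -> : odd (size q) by move: os; rewrite size_s /= negbK oddD (negbTE ep).
by move=> /(_ isT isT); case: p {def_s size_s pp rpy ep} => //= z p; lia.
Qed.

Lemma shortest_odd_cycle_neighbors s x : irreflexive r -> shortest_odd_cycle s ->
  x \in s -> #|[set y in [set z in s] | r x y]| = 2.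
Proof.
move=> irr_r ss xs; have [cs os mins] := ss; have us := shortest_odd_cycle_uniq ss.
have [i t def_s] := rot_to xs.
have ct : cycle r (x :: t) by rewrite -def_s rot_cycle.
have ot : odd (size (x :: t)) by rewrite -def_s size_rot.
have ut : uniq (x :: t) by rewrite -def_s rot_uniq.
case: t def_s ct ot ut => [|a t] def_s ct ot ut; first by rewrite /= irr_r in ct.
have [b tb] : exists b, b = last a t by exists (last a t).
have -> : [set y in [set z in s] | r x y] = [set a; b].
  apply/setP => y; rewrite !inE -(mem_rot i s) def_s.
  move: ct; rewrite /= rcons_path -tb => /and3P[rxa _ rbx].
  apply/andP/orP => [[]|[]/eqP ->].
  - rewrite inE => /orP[/eqP ->|yt rxy]; first by rewrite irr_r.
    have [p [q eq_t]] : exists p q, a :: t = p ++ y :: q.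
      by case/splitPr: yt => p q; exists p, q.
    rewrite eq_t in def_s; case: (shortest_odd_cycle_chord ss def_s rxy) => eq; subst.
      by left; case: eq_t => ->.
    right; have /= : last x (a :: t) = last x (p ++ [:: y]) by rewrite eq_t.
    by rewrite last_cat /= => ->.
  - by rewrite !inE eqxx orbT.
  - by rewrite sym_r rbx tb inE mem_last orbT.
rewrite cards2; case: eqP => // ab; case: t ot ut tb def_s {ct} => [|z t] // _ ut tb _.
by move: ut; rewrite /= ab tb /= mem_last /= andbF.
Qed.

End OddWalks.

Lemma graph_iso_onto (T1 T2 : finType) (e1 : rel T1) (e2 : rel T2) (g : T2 -> T1) :
  injective g -> #|T1| <= #|T2| -> (forall i j, e1 (g i) (g j) = e2 i j) ->
  graph_iso e1 e2.
Proof.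
move=> inj_g le_card ge; have [f gK fK] := inj_card_bij inj_g le_card.
by exists f => [|x y]; [exists g | rewrite -ge !fK].
Qed.

Lemma subgraph_iso_onto (T T2 : finType) (U : {set T}) (d : rel T) (e2 : rel T2) (g : T2 -> T) :
  injective g -> (forall i, g i \in U) -> #|U| <= #|T2| ->
  (forall i j, d (g i) (g j) = e2 i j) -> graph_iso (subgraph_rel U d) e2.
Proof.
move=> inj_g gU le_card ge; apply: (@graph_iso_onto _ _ _ _ (fun i => exist _ (g i) (gU i))).
- by move=> i j [] /inj_g.
- by rewrite card_sig; apply: leq_trans le_card; apply: subset_leq_card; apply/subsetP.
- by move=> i j; apply: ge.
Qed.

Section Ears.
Variables (T : finType) (e : rel T).
Hypothesis simple_e : simple_graph e.
Implicit Types (x y z : T) (U W : {set T}) (s p q : seq T).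

Lemma first_hit (r : rel T) W z p : path r z p -> uniq (z :: p) -> z \notin W ->
  last z p \in W -> exists p1 y, [/\ y \in W, path r z (rcons p1 y), {subset p1 <= p},
    uniq (z :: p1) & forall x, x \in z :: p1 -> x \notin W].
Proof.
elim: p z => [|a p IHp] z /=; first by move=> _ _ /negbTE ->.
move=> /andP[rza pp] /and3P[zap ap up] zW lW.
have [aW|aW] := boolP (a \in W).
  by exists [::], a; split=> //= [|x]; rewrite ?rza // inE => /eqP ->.
have [|p1 [y [yW pp1 sub up1 nW]]] := IHp a pp _ aW lW; first by rewrite /= ap.
exists (a :: p1), y; split=> //; first by rewrite /= rza.
- by move=> x; rewrite !inE => /orP[->//|/sub ->]; rewrite orbT.
- rewrite [uniq _]up1 andbT; apply: contra zap.
  by rewrite !inE => /orP[->//|/sub ->]; rewrite orbT.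
- by move=> x; rewrite inE => /orP[/eqP ->|/nW].
Qed.

(** Take an edge xz leaving [W]. As [x] is no cut vertex, [z] reaches another vertex of [W] without
    [x]; the first return to [W] is [y]. So the ends differ, and [z] makes the interior nonempty. *)
Lemma ear U W : nonseparable e U (induced_rel e U) -> W \subset U -> W != U -> 1 < #|W| ->
  exists x y p, [/\ x \in W, y \in W, x != y & path e x (rcons p y)] /\
    [/\ p != [::], uniq p & forall z, z \in p -> z \in U /\ z \notin W].
Proof.
set r := induced_rel e U => -[[_ _ conn] nocut] WU nWU gt1.
have sym_r : symmetric r := induced_sym simple_e U.
have [x [z [xW zW rxz]]] : exists x z, [/\ x \in W, z \notin W & r x z].
  apply: contrapT => none; case/negP: nWU; rewrite eqEsubset WU /=; apply/subsetP => u uU.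
  have /card_gt0P[w wW] : 0 < #|W| by apply: ltnW.
  have clW : closed r (mem W).
    apply: intro_closed => [|a b rab aW]; first exact: sym_connect_sym.
    by apply: contraT => bW; case: none; exists a, b.
  have eq_wu : (w \in W) = (u \in W) := closed_connect clW (conn w u (subsetP WU w wW) uU).
  by rewrite -eq_wu.
have [w wW nwx] : exists2 w, w \in W & w != x.
  have /card_gt1P[a [b [aW bW nab]]] := gt1.
  have [eqax|] := eqVneq a x; last by exists a.
  by exists b => //; rewrite -eqax eq_sym.
have /and3P[xU zU exz] := rxz.
have nzx : z != x by rewrite eq_sym (edge_neq simple_e exz).
have : connect (del_vertex r x) z w.
  apply/negPn/negP => ncon; apply: (nocut x); split=> //; exists z, w.
  have wU := subsetP WU w wW.
  by split; rewrite ?in_setD1 ?nzx ?nwx //; apply: conn.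
case/connectP => p0 pp0 lw; case/shortenP: pp0 lw => p pp up _ lw.
have [|p1 [y [yW pp1 _ up1 nW]]] := first_hit pp up zW; first by rewrite -lw.
exists x, y, (z :: p1); split; split=> //.
- move: pp1; rewrite rcons_path => /andP[_ /and3P[_ _]].
  by rewrite eq_sym.
- rewrite /= exz; apply: sub_path pp1 => a b; by case/andP => /and3P[].
move=> a ap; split; last exact: nW.
suff : all (mem U) (z :: p1) by move/allP/(_ a ap).
rewrite /= zU; elim: (p1) (z) pp1 => //= b q IHq c /andP[/andP[/and3P[_ bU _] _] /IHq ->].
by rewrite bU.
Qed.

End Ears.

(** * Blocks of cubic type *)

Section Classification.
Variables (T : finType) (e : rel T).
Hypothesis simple_e : simple_graph e.
Implicit Types (x y z : T) (S U W : {set T}) (s p q : seq T).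

Let sym_e : symmetric e := simple_e.1.

Lemma odd_cycle_walk s : cycle e s -> uniq s -> odd (size s) -> odd_cycle e s.
Proof. by rewrite /odd_cycle => -> -> ->. Qed.

Lemma inner_degree_le S x : #|[set y in S | e x y]| <= degree e x.
Proof. by apply: subset_leq_card; apply/subsetP => y; rewrite !inE => /andP[]. Qed.

Lemma ecount_seq s : uniq s ->
  \sum_(x <- s) \sum_(y <- s) (e x y : nat) = (ecount e [set x in s]).*2.
Proof.
move=> us; rewrite -(handshake simple_e) (big_uniq _ us) /=.
rewrite [RHS](eq_bigl (fun x => x \in s)) => [|x]; last by rewrite inE.
apply: eq_bigr => x _; rewrite (big_uniq _ us) /= -big_mkcondr sum1dep_card.
by apply: eq_card => y; rewrite !inE.
Qed.

Hypothesis degree3 : forall v, degree e v <= 3.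

Lemma degree_lt4 v a b c d : e v a -> e v b -> e v c -> e v d -> ~~ uniq [:: a; b; c; d].
Proof.
move=> va vb vc vd; apply/negP => u4; have := degree3 v.
rewrite leqNgt => /negP; apply; have <- : #|[set w in [:: a; b; c; d]]| = 4.
  by rewrite cardsE; apply/card_uniqP.
apply: subset_leq_card; apply/subsetP => w; rewrite !inE.
by case/or4P => /eqP ->.
Qed.

Hypothesis odd_cycle_count : forall s, odd_cycle e s ->
  (ecount e [set x in s]).+1 = 4 * (size s)./2.

(** A cycle on 2m + 1 vertices spans 4m - 1 edges, and degrees at most 3 give 2 (4m - 1) <= 3 (2m +
    1), that is m <= 2. *)
Lemma odd_cycle_size35 s : odd_cycle e s -> size s = 3 \/ size s = 5.
Proof.
move=> os; have := odd_cycle_size simple_e os; have := odd_cycle_count os.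
have : (ecount e [set x in s]).*2 <= 3 * size s.
  rewrite -(handshake simple_e).
  have <- : \sum_(x in [set x in s]) 3 = 3 * size s.
    by rewrite sum_nat_const mulnC cardsE; case/and3P: os => _ /card_uniqP ->.
  by apply: leq_sum => x _; apply: leq_trans (inner_degree_le _ _) (degree3 x).
have /and3P[_ _ o_s] := os; move: (ecount _ _) => c.
have := odd_double_half (size s); rewrite o_s; move: (size s)./2 (size s); clear; lia.
Qed.

(* Seven edges on five vertices of degree at most 3 leave room for at most one
   edge to the outside. *)
Lemma odd_cycle5_exit s x y x' y' : odd_cycle e s -> size s = 5 ->
  x \in s -> y \in s -> x' \notin s -> y' \notin s -> e x x' -> e y y' -> x = y.
Proof.
move=> os s5 xs ys xs' ys' exx' eyy'; apply/eqP/negPn/negP => nxy.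
set S := [set x in s]; pose X := [set z in S | [exists z', (z' \notin s) && e z z']].
have gt1 : 1 < #|X|.
  apply/card_gt1P; exists x, y; rewrite !inE xs ys; split=> //.
    by apply/existsP; exists x'; rewrite xs'.
  by apply/existsP; exists y'; rewrite ys'.
have cS : #|S| = 5 by rewrite cardsE; case/and3P: os => _ /card_uniqP ->.
have : \sum_(z in S) (#|[set w in S | e z w]| + (z \in X)) <= \sum_(z in S) 3.
  apply: leq_sum => z zS; apply: leq_trans (degree3 z).
  rewrite /degree -(cardsID S [set w | e z w]) leq_add //.
    by apply: subset_leq_card; apply/subsetP => w; rewrite !inE andbC.
  rewrite inE zS; case: existsP => // -[z' /andP[zs' ezz']].
  by apply/card_gt0P; exists z'; rewrite !inE zs' ezz'.
rewrite big_split /= (handshake simple_e) sum_nat_const cS.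
have -> : \sum_(z in S) (z \in X) = #|X|.
  rewrite -big_mkcondr sum1dep_card; apply: eq_card => z; rewrite !inE.
  by case: (z \in s).
have := odd_cycle_count os; rewrite s5 -/S -[5./2]/2; move: #|X| gt1 => n.
by move: (ecount e S) => c; clear; lia.
Qed.

Lemma C5_table (i j : 'Z_5) :
  C5 i j = ((val i, val j) \in [:: (0, 1); (1, 0); (1, 2); (2, 1); (2, 3); (3, 2);
                                   (3, 4); (4, 3); (0, 4); (4, 0)]).
Proof. by case: i j => [[|[|[|[|[|i]]]]] Hi] [[|[|[|[|[|j]]]]] Hj]. Qed.

Lemma C5'_table (i j : 'Z_5) :
  C5' i j = ((val i, val j) \in [:: (0, 1); (1, 0); (1, 2); (2, 1); (2, 3); (3, 2);
                                    (3, 4); (4, 3); (0, 4); (4, 0);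
                                    (1, 3); (3, 1); (2, 4); (4, 2)]).
Proof. by case: i j => [[|[|[|[|[|i]]]]] Hi] [[|[|[|[|[|j]]]]] Hj]. Qed.

(** An ear on the 5-cycle would need two vertices with neighbours outside, so the cycle exhausts
    [U]; it remains to place its two chords. *)
Lemma block_C5' U s : nonseparable e U (induced_rel e U) ->
  odd_cycle e s -> size s = 5 -> {subset s <= U} ->
  graph_iso (subgraph_rel U (induced_rel e U)) C5'.
Proof.
move=> nsU os s5 sU; have /and3P[_ us _] := os.
have cS : #|[set x in s]| = 5 by rewrite cardsE (card_uniqP us).
have SU : [set x in s] = U.
  apply/eqP; apply: contraT => nSU; have [||x [y [p [[xS yS nxy pp] [p0 _ pU]]]]] := ear simple_e nsU _ nSU.
  - by apply/subsetP => x; rewrite inE => /sU.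
  - by rewrite cS.
  case: p p0 pp pU => // z p _ /= /andP[exz]; rewrite rcons_path => /andP[_ ely] pU.
  case/negP: nxy; apply/eqP; rewrite !inE in xS yS.
  apply: (odd_cycle5_exit os s5 xS yS _ _ exz (_ : e y (last z p))).
  - by have [_] := pU z (mem_head _ _); rewrite inE.
  - by have [_] := pU (last z p) (mem_last _ _); rewrite inE.
  - by rewrite sym_e.
have count s' : odd_cycle e s' -> size s' = 5 -> (\sum_(x <- s') \sum_(y <- s') (e x y : nat)) = 14.
  move=> os' s5'; have /and3P[_ us' _] := os'; rewrite ecount_seq //.
  by have := odd_cycle_count os'; rewrite s5' => -[->].
have inner_le s' x : uniq s' -> \sum_(y <- s') (e x y : nat) <= 3.
  move=> us'; apply: leq_trans (degree3 x); apply: leq_trans (inner_degree_le [set z in s'] x).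
  rewrite (big_uniq _ us') -big_mkcondr sum1dep_card; apply: subset_leq_card.
  by apply/subsetP => y; rewrite !inE.
(* The degree sum is 14 < 15, so some vertex has no chord; the cycle is rotated to start there. *)
have [x xs deg_x] : exists2 x, x \in s & \sum_(y <- s) (e x y : nat) <= 2.
  apply: contrapT => none; have := count s os s5; rewrite big_seq => c14.
  have : \sum_(x <- s | x \in s) 3 <= \sum_(x <- s | x \in s) \sum_(y <- s) (e x y : nat).
    by apply: leq_sum => x xs; rewrite ltnNge; apply/negP => le2; apply: none; exists x.
  by rewrite c14 -big_seq big_const_seq count_predT s5.
have [i t def_s] := rot_to xs.
have ot : odd_cycle e (x :: t) by rewrite -def_s odd_cycle_rot.
have deg_xt : \sum_(y <- x :: t) (e x y : nat) <= 2.
  by rewrite -def_s (perm_big s) // perm_rot.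
have t5 : size (x :: t) = 5 by rewrite -def_s size_rot.
have tU : U = [set z in x :: t].
  by rewrite -SU -def_s; apply/setP => z; rewrite !inE mem_rot.
case: t def_s ot deg_xt t5 tU => [|b [|c [|d [|f [|g t]]]]] // def_s ot deg_x' t5 tU.
have /and3P[cyc ut _] := ot; have /and5P[exb ebc ecd edf /andP[efx _]] := cyc.
have c14 := count _ ot t5.
have := inner_le _ b ut; have := inner_le _ f ut; move: deg_x' c14.
rewrite !big_cons !big_nil !simple_e.2 ![e b x]sym_e ![e c x]sym_e ![e d x]sym_e ![e f x]sym_e.
rewrite ![e c b]sym_e ![e d b]sym_e ![e f b]sym_e ![e d c]sym_e ![e f c]sym_e ![e f d]sym_e.
rewrite exb ebc ecd edf [e x f]sym_e efx.
(* No chord meets [x], leaving bd, bf and cf for two chords. Both [b] and [f] allow only one chord,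
   so these are bd and cf, the chords {1, 3} and {2, 4} of [C5']. *)
case exc: (e x c); case exd: (e x d) => //; case ebd: (e b d); case ebf: (e b f) => //;
  case ecf: (e c f) => // _ _ _ _.
pose g (i : 'Z_5) := nth x [:: x; b; c; d; f] i.
have U5 : #|U| = 5 by rewrite -SU cS.
apply: (@subgraph_iso_onto _ _ _ _ _ g).
- by move=> u v /eqP; rewrite nth_uniq ?ltn_ord // => /eqP/val_inj.
- by move=> u; rewrite tU inE mem_nth // ltn_ord.
- by rewrite card_ord U5.
move=> u v; have gU w : g w \in U by rewrite tU inE mem_nth // ltn_ord.
rewrite /induced_rel /= !gU C5'_table /g.
by case: u v {gU} => [[|[|[|[|[|u]]]]] Hu] [[|[|[|[|[|v]]]]] Hv] //=;
  rewrite ?simple_e.2 ?exb ?ebc ?ecd ?edf ?efx ?exc ?exd ?ebd ?ebf ?ecf // sym_e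
          ?exb ?ebc ?ecd ?edf ?efx ?exc ?exd ?ebd ?ebf ?ecf.
Qed.

Lemma block_complete U x t (s := x :: t) : uniq s -> U = [set z in s] ->
  {in s &, forall y z, y != z -> e y z} ->
  graph_iso (subgraph_rel U (induced_rel e U)) (complete_graph (size s)).
Proof.
move=> us defU es; pose g (i : 'I_(size s)) := nth x s i.
have gs i : g i \in s by rewrite mem_nth.
have inj_g : injective g.
  by move=> i j /eqP; rewrite nth_uniq // => /eqP/val_inj.
have gU i : g i \in U by rewrite defU inE.
apply: (subgraph_iso_onto inj_g gU) => [|i j].
  by rewrite card_ord defU cardsE (card_uniqP us).
rewrite /induced_rel /complete_graph /= !gU /=.
have [->|nij] := eqVneq i j; first by rewrite simple_e.2.
by rewrite es // (inj_eq inj_g).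
Qed.

End Classification.

Section Blocks.
Variables (T : finType) (e : rel T).
Hypothesis simple_e : simple_graph e.
Implicit Types (x y z : T) (S U W : {set T}) (s p q : seq T).

Let sym_e : symmetric e := simple_e.1.

(** Adding edges on the same vertices only connects more pairs and creates no cut vertex. By
    maximality, blocks are therefore induced. *)
Lemma nonseparable_induced U (d : rel T) : nonseparable e U d ->
  nonseparable e U (induced_rel e U) /\ subrel d (induced_rel e U).
Proof.
case=> -[[sym_d subd] U0 conn] nocut.
have sub_d : subrel d (induced_rel e U).
  by move=> x y /subd[xU yU exy]; rewrite /induced_rel /= xU yU.
have conn_sub (r1 r2 : rel T) : subrel r1 r2 -> forall x y, connect r1 x y -> connect r2 x y.
  by move=> sub12; apply: connect_sub => x y /sub12; apply: connect1.
split=> //; split=> [|v [vU [x [y [xU yU _]]]]].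
  split=> //; first exact: induced_subgraph.
  by move=> x y xU yU; apply: conn_sub sub_d _ _ (conn x y xU yU).
have [dxy|ndxy _] := boolP (connect (del_vertex d v) x y).
  case/negP; apply: conn_sub dxy => a b /and3P[dab av bv].
  by apply/and3P; split=> //; apply: sub_d.
apply: (nocut v); split=> //; exists x, y; split=> //.
by apply: conn; [case/setD1P: xU | case/setD1P: yU].
Qed.

(** The vertices are numbered part by part, so 2 and 3 form the part of size two and [minn _ 2]
    recovers the part. *)
Lemma K112_code : exists code : {i : 'I_3 & 'I_(tnth [tuple 1; 1; 2] i)} -> 'I_4,
  [/\ injective code, #|{: {i : 'I_3 & 'I_(tnth [tuple 1; 1; 2] i)}}| = 4
    & forall i j, K112 i j = (minn (code i) 2 != minn (code j) 2)].
Proof.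
pose code (i : {i : 'I_3 & 'I_(tnth [tuple 1; 1; 2] i)}) : 'I_4 := inord (tag i + tagged i).
have codeE i : code i = tag i + tagged i :> nat.
  by rewrite inordK //; case: i => -[[|[|[|i]]] Hi] [[|[|j]] Hj].
have tagE i : minn (code i) 2 = tag i.
  by rewrite codeE; case: i => -[[|[|[|i]]] Hi] [[|[|j]] Hj].
exists code; split.
- move=> i j eqc; have eqt : tag i = tag j by apply: val_inj; rewrite /= -!tagE eqc.
  have := codeE i; rewrite eqc codeE {eqc}; case: i j eqt => [i u] [j v] /= eqt; subst j.
  by move/addnI/val_inj => ->.
- by rewrite card_tagged sumnE big_map big_enum /= !big_ord_recl big_ord0 !card_ord.
- by move=> i j; rewrite !tagE.
Qed.

Section CubicCase.
Hypothesis degree3 : forall v, degree e v <= 3.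
Hypothesis odd_cycle_count : forall s, odd_cycle e s ->
  (ecount e [set x in s]).+1 = 4 * (size s)./2.

(** If [U] has only these four vertices, the pair cp decides between K4 and K112. Otherwise an ear
    exists, and closing it through [a], or through [a] and [b], gives an odd cycle of length at
    least 5, hence exactly 5. *)
Lemma block_diamond U (a b c p : T) : nonseparable e U (induced_rel e U) ->
  [/\ a \in U, b \in U, c \in U & p \in U] ->
  e a b -> e a c -> e b c -> e a p -> e b p -> c != p ->
  let B := subgraph_rel U (induced_rel e U) in
  [\/ graph_iso B (complete_graph 4), graph_iso B K112 | graph_iso B C5'].
Proof.
move=> nsU [aU bU cU pU] eab eac ebc eap ebp ncp B.
pose s := [:: a; b; c; p]; have us : uniq s.
  by rewrite /= !inE !negb_or ncp !(edge_neq simple_e).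
have sU : [set z in s] \subset U.
  by apply/subsetP => z; rewrite !inE => /or4P[]/eqP ->.
have [defU|nUW] := eqVneq [set z in s] U.
  have cU4 : #|U| = 4 by rewrite -defU cardsE (card_uniqP us).
  have [ecp|necp] := boolP (e c p).
    apply: Or31; apply: (block_complete simple_e us) => //.
    move=> y z; rewrite !inE => /or4P[]/eqP -> /or4P[]/eqP ->; rewrite ?eqxx // => _; by rewrite sym_e.
  have [code [inj_code cardK codeE]] := K112_code.
  apply: Or32; apply: (@subgraph_iso_onto _ _ _ _ _ (fun i => nth a s (code i))).
  - by move=> i j /eqP; rewrite nth_uniq // => /eqP/val_inj/inj_code.
  - by move=> i; apply: (subsetP sU); rewrite inE mem_nth.
  - by rewrite cardK cU4.
  move=> i j; have codeU k : nth a s (code k) \in U by apply: (subsetP sU); rewrite inE mem_nth.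
  rewrite /induced_rel /= !codeU codeE /=.
  case: (code i) (code j) => [[|[|[|[|u]]]] Hu] [[|[|[|[|v]]]] Hv] //=;
    by rewrite ?simple_e.2 // ?eab ?eac ?ebc ?eap ?ebp ?(negbTE necp) // sym_e
               ?eab ?eac ?ebc ?eap ?ebp ?(negbTE necp).
have [|x [y [q [[xW yW nxy pq] [q0 uq qU]]]]] := ear simple_e nsU sU nUW.
  by rewrite cardsE (card_uniqP us).
have qW z : z \in q -> z \notin s by case/qU; rewrite inE.
(* Both [a] and [b] already have three neighbours in the diamond, so the ear runs between [c] and
   [p]. *)
have exit w z : w \in s -> z \notin s -> e w z -> (w == c) || (w == p).
  move=> ws zs ewz; move: zs; rewrite !inE !negb_or => /and4P[zna znb znc znp].
  have := ws; rewrite !inE => /or4P[]/eqP wE; subst w; rewrite ?eqxx ?orbT //.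
    have := degree_lt4 degree3 eab eac eap ewz; rewrite /= !inE !negb_or !(eq_sym _ z) znb znc znp ncp.
    by rewrite !(edge_neq simple_e).
  rewrite sym_e in eab; have := degree_lt4 degree3 eab ebc ebp ewz.
  by rewrite /= !inE !negb_or !(eq_sym _ z) zna znc znp ncp !(edge_neq simple_e).
have ends w : (w == c) || (w == p) -> [/\ e a w, e b w & w \in U].
  by case/orP => /eqP ->.
rewrite !in_set in xW yW.
have [z [t def_q]] : exists z t, q = z :: t by case: (q) q0 => // z t; exists z, t.
have [eax ebx xU] : [/\ e a x, e b x & x \in U].
  apply/ends/(exit x z) => //; first by apply: qW; rewrite def_q mem_head.
  by move: pq; rewrite def_q /= => /andP[].
have [eay eby yU] : [/\ e a y, e b y & y \in U].
  apply/ends/(exit y (last z t)) => //; first by apply: qW; rewrite def_q mem_last.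
  by move: pq; rewrite def_q /= rcons_path => /and3P[_ _]; rewrite sym_e.
have nq w : w \in s -> w \notin q by move=> ws; apply/negP => /qW; rewrite ws.
have [[xq yq] [aq bq]] : (x \notin q /\ y \notin q) /\ (a \notin q /\ b \notin q).
  by split; split; apply: nq; rewrite // !inE eqxx ?orbT.
have [nxa nya] : x != a /\ y != a by rewrite ![_ == a]eq_sym !(edge_neq simple_e).
have [nxb nyb] : x != b /\ y != b by rewrite ![_ == b]eq_sym !(edge_neq simple_e).
have nba : b != a by rewrite eq_sym (edge_neq simple_e).
have [oq|eq] := boolP (odd (size q)).
  pose s' := x :: rcons (rcons (rcons q y) a) b.
  have os' : odd_cycle e s'.
    apply: odd_cycle_walk; last by rewrite /= !size_rcons /= oq.
      by rewrite /= 3!rcons_path !last_rcons pq [e y a]sym_e eay eab ebx.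
    rewrite /= !rcons_uniq !(mem_rcons, inE) !negb_or uq xq yq aq bq nxy nxa nxb.
    by rewrite nba ![_ == y]eq_sym nya nyb.
  have [|s5] := odd_cycle_size35 simple_e degree3 odd_cycle_count os'.
    by rewrite /= !size_rcons.
  apply: Or33; apply: (block_C5' simple_e degree3 odd_cycle_count nsU os' s5) => w.
  rewrite !(inE, mem_rcons) => /orP[/eqP ->//|/or3P[/eqP ->//|/eqP ->//|/orP[/eqP ->//|/qU[]//]]].
(* For an even ear the 5-cycle omits [b], to which both [x] and [y] are adjacent: two exits, a
   contradiction. *)
pose s' := x :: rcons (rcons q y) a.
have os' : odd_cycle e s'.
  apply: odd_cycle_walk; last by rewrite /= !size_rcons /= negbK.
    by rewrite /= 2!rcons_path !last_rcons pq [e y a]sym_e eay eax.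
  by rewrite /= !rcons_uniq !(mem_rcons, inE) !negb_or uq xq yq aq nxy nxa [_ == y]eq_sym nya.
have [|s5] := odd_cycle_size35 simple_e degree3 odd_cycle_count os'.
  by rewrite /s' def_q /= !size_rcons.
have bs' : b \notin s'.
  by rewrite !(inE, mem_rcons) !negb_or bq nba ![b == _]eq_sym nxb nyb.
case/eqP: nxy; apply: (odd_cycle5_exit simple_e degree3 odd_cycle_count os' s5 _ _ bs' bs').
- by rewrite mem_head.
- by rewrite !(inE, mem_rcons) eqxx !orbT.
- by rewrite sym_e.
- by rewrite sym_e.
Qed.

Lemma shortest_odd_cycle_induced U s : shortest_odd_cycle (induced_rel e U) s ->
  [/\ odd_cycle e s, {subset s <= U} & ecount e [set x in s] = size s].
Proof.
move=> ss; have [cs os _] := ss.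
have us := shortest_odd_cycle_uniq ss.
have irr_r : irreflexive (induced_rel e U) by move=> x; rewrite /induced_rel /= simple_e.2 !andbF.
have nbr x := shortest_odd_cycle_neighbors (induced_sym simple_e U) irr_r ss (x := x).
have sU : {subset s <= U}.
  move=> x /nbr c2; have /card_gt0P[y] : 0 < #|[set y in [set z in s] | induced_rel e U x y]|.
    by rewrite c2.
  by rewrite inE => /andP[_ /and3P[]].
have ose : odd_cycle e s.
  apply: odd_cycle_walk => //; case: (s) cs => //= x t; apply: sub_path => a b.
  by case/and3P.
split=> //; apply: double_inj; rewrite -(handshake simple_e).
rewrite (eq_bigr (fun=> 2)) ?sum_nat_const ?muln2 ?cardsE ?(card_uniqP us) // => x.
rewrite inE => xs; rewrite -(nbr x xs); apply: eq_card => y; rewrite !inE.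
by case ys: (y \in s) => //; rewrite /induced_rel /= !sU.
Qed.

(** A shortest odd cycle has no chord, so length 5 would give five edges instead of seven: it is a
    triangle xyt. An even ear from [x] to [y] closes through [t] to a 5-cycle. An odd ear closes
    through the edge xy: length 5 is impossible, as [x] and [y] both exit to [t], and length 3
    yields a diamond. *)
Lemma block_classification U : nonseparable e U (induced_rel e U) ->
  let B := subgraph_rel U (induced_rel e U) in
  bipartite B \/ graph_iso B (complete_graph 3) \/ graph_iso B (complete_graph 4) \/
  graph_iso B K112 \/ graph_iso B C5'.
Proof.
move=> nsU B; case: (bipartite_or_odd_walk (induced_sym simple_e U)) => [[A bipA]|walk].
  by left; exists [set x : {x | x \in U} | val x \in A] => x y /bipA; rewrite !inE.
right; have [s ss] := shortest_odd_cycle_exists walk.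
have [os sU es] := shortest_odd_cycle_induced ss; have /and3P[cs us _] := os.
have s3 : size s = 3.
  have [//|s5] := odd_cycle_size35 simple_e degree3 odd_cycle_count os.
  by have := odd_cycle_count os; rewrite es s5.
have tri : {in s &, forall y z, y != z -> e y z}.
  case: (s) s3 cs => [|a [|b [|c [|? ?]]]] //= _ /and4P[eab ebc eca _] y z.
  rewrite !inE => /or3P[]/eqP -> /or3P[]/eqP ->; rewrite ?eqxx // => _; by rewrite sym_e.
have SU : [set z in s] \subset U by apply/subsetP => z; rewrite inE => /sU.
have c3 : #|[set z in s]| = 3 by rewrite cardsE (card_uniqP us).
have [defU|nUW] := eqVneq [set z in s] U.
  left; case: s us defU tri s3 {cs ss os sU es SU c3} => // x t us defU tri s3.
  by have := block_complete simple_e us (esym defU) tri; rewrite s3.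
have [|x [y [p [[xs ys nxy pp] [p0 up pU]]]]] := ear simple_e nsU SU nUW; first by rewrite c3.
have [t] : exists t, t \in [set z in s] :\ x :\ y.
  apply/card_gt0P; have := c3; rewrite (cardsD1 x) xs (cardsD1 y) in_setD1 ys eq_sym nxy.
  by rewrite !add1n => -[->].
rewrite !inE in xs ys *; case/and3P => nty ntx ts.
have [[exy ext] eyt] : (e x y /\ e x t) /\ e y t.
  by split; [split|]; apply: tri; rewrite // eq_sym.
have nps w : w \in s -> w \notin p by move=> ws; apply/negP => /pU[_]; rewrite inE ws.
have [[xp yp] tp] := ((nps x xs, nps y ys), nps t ts).
have [op|ep] := boolP (odd (size p)).
  pose s' := x :: rcons p y.
  have os' : odd_cycle e s'.
    apply: odd_cycle_walk; last by rewrite /= size_rcons /= negbK.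
      by rewrite /= rcons_path last_rcons pp sym_e.
    by rewrite /= !rcons_uniq !(mem_rcons, inE) !negb_or up xp yp nxy.
  have [s3'|s5] := odd_cycle_size35 simple_e degree3 odd_cycle_count os'; last first.
    have ts' : t \notin s' by rewrite !(inE, mem_rcons) !negb_or ntx nty tp.
    case/eqP: nxy; apply: (odd_cycle5_exit simple_e degree3 odd_cycle_count os' s5 _ _ ts' ts') => //.
    - by rewrite mem_head.
    - by rewrite !(inE, mem_rcons) eqxx !orbT.
  have p1 : size p = 1 by move: s3'; rewrite /= size_rcons => -[].
  case: p p1 pp pU tp {s3' os' s' p0 up nps xp yp op} => [|z [|? ?]] //= _.
  case/and3P => exz ezy _ pU; rewrite inE => ntz.
  have [zU _] := pU z (mem_head _ _).
  have inU : [/\ x \in U, y \in U, t \in U & z \in U] by split=> //; apply: sU.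
  rewrite sym_e in ezy.
  by case: (block_diamond nsU inU exy ext eyt exz ezy ntz) => iso; right; [left|right; left|right; right].
pose s' := x :: rcons (rcons p y) t.
have os' : odd_cycle e s'.
  apply: odd_cycle_walk; last by rewrite /= !size_rcons /= negbK.
    by rewrite /= 2!rcons_path !last_rcons pp eyt sym_e ext.
  by rewrite /= !rcons_uniq !(mem_rcons, inE) !negb_or up xp yp tp nxy nty eq_sym ntx.
have [s3'|s5] := odd_cycle_size35 simple_e degree3 odd_cycle_count os'.
  by move: s3'; rewrite /= !size_rcons => -[]; case: (p) p0.
do 3!right; apply: (block_C5' simple_e degree3 odd_cycle_count nsU os' s5) => w.
by rewrite !(inE, mem_rcons) => /or4P[/eqP->|/eqP->|/eqP->|/pU[]] //; apply: sU.
Qed.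

End CubicCase.

(** * From the facet conditions to the three families *)

Lemma necessity k : connected_graph e ->
  (forall v, essential e v -> (degree e v).+1 = k) ->
  (forall s, odd_cycle e s -> (ecount e [set x in s]).+1 = k * (size s)./2) ->
  [\/ bipartite e /\ (forall u v, essential e u -> essential e v -> degree e u = degree e v),
      graph_iso e C5
    | (forall u, essential e u -> degree e u = 3) /\
      (forall (U : {set T}) (d : rel T), block e U d ->
         let b := subgraph_rel U d in
         bipartite b \/ graph_iso b (complete_graph 3) \/
         graph_iso b (complete_graph 4) \/ graph_iso b K112 \/
         graph_iso b C5')].
Proof.
move=> [T0 conn] ess count.
case: (bipartite_or_odd_walk sym_e) => [bip|walk].
  by apply: Or31; split=> // u v /ess eu /ess ev; apply: succn_inj; rewrite eu ev.
have [s ss] := shortest_odd_cycle_exists walk.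
have eT : induced_rel e setT = e.
  by apply/funext => x; apply/funext => y; rewrite /induced_rel /= !in_setT.
have [os _ es] : [/\ odd_cycle e s, {subset s <= [set: T]} & ecount e [set x in s] = size s].
  by apply: shortest_odd_cycle_induced; rewrite eT.
have /and3P[cs us o_s] := os; have gt2 := odd_cycle_size simple_e os.
have kE : (k = 3 /\ size s = 5) \/ (k = 4 /\ size s = 3).
  have := count s os; rewrite es; have := odd_double_half (size s); rewrite o_s.
  move: gt2; move: (size s)./2 => m; move: (size s) => n; clear.
  case: m => [|[|[|m]]]; rewrite -muln2; try lia.
  move=> _ <-; case: k => [|[|[|k]]]; nia.
case: kE => -[kE sE]; last first.
  apply: Or33; have degree3 v : degree e v <= 3.
    rewrite leqNgt; apply/negP => gt3; have := ess v; rewrite kE => ess_v.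
    have := ess_v (Or33 _ _ (ltnW gt3)); lia.
  have count4 s' : odd_cycle e s' -> (ecount e [set x in s']).+1 = 4 * (size s')./2.
    by rewrite -kE; apply: count.
  split=> [u /ess|U d [nsd maxd] b]; first by rewrite kE => -[].
  have [nsU subd] := nonseparable_induced nsd.
  have [_ eq_d] := maxd U _ nsU (subxx _) subd.
  have def_d : d = induced_rel e U by apply/funext => x; apply/funext => y; rewrite eq_d.
  by rewrite /b def_d; apply: block_classification.
apply: Or32.
(* A vertex of degree at least 3 would be essential and so have degree k - 1 = 2. Hence the 5-cycle
   has no edges to other vertices, and connectedness makes it the whole graph. *)
have degree2 v : degree e v <= 2.
  rewrite leqNgt; apply/negP => gt2'; have := ess v (Or33 _ _ gt2'); lia.
have nbr x : x \in s -> #|[set y in [set z in s] | e x y]| = 2.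
  exact: (shortest_odd_cycle_neighbors sym_e simple_e.2 ss).
have clS x y : x \in s -> e x y -> y \in s.
  move=> xs exy; have eqN : [set y in [set z in s] | e x y] = [set y | e x y].
    apply/eqP; rewrite eqEcard nbr //; apply/andP; split; last exact: degree2.
    by apply/subsetP => z; rewrite !inE => /andP[].
  by have /setP/(_ y) := eqN; rewrite !inE exy andbT.
have allS y : y \in s.
  have [x xs] : exists x, x \in s by case: (s) gt2 => // x; exists x; rewrite inE eqxx.
  have clE : closed e (mem s).
    by apply: intro_closed => [|a b eab as_]; [apply: sym_connect_sym | apply: clS eab].
  have eq_xy : (x \in s) = (y \in s) := closed_connect clE (conn x y).
  by rewrite -eq_xy.
have nbr_sum x : \sum_(y <- s) (e x y : nat) = 2.
  rewrite -(nbr x (allS x)) (big_uniq _ us) -big_mkcondr sum1dep_card.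
  by apply: eq_card => y; rewrite !inE.
case: s us allS nbr_sum cs sE {ss os es o_s gt2 nbr clS walk} => [|a [|b [|c [|d [|f [|? ?]]]]]] //.
move=> us allS nbr_sum /and5P[eab ebc ecd edf /andP[efa _]] _.
have := nbr_sum a; have := nbr_sum b; have := nbr_sum c; have := nbr_sum d.
rewrite !big_cons !big_nil !simple_e.2 ![e b a]sym_e ![e c a]sym_e ![e d a]sym_e ![e a f]sym_e.
rewrite ![e c b]sym_e ![e d b]sym_e ![e d c]sym_e.
rewrite eab ebc ecd edf efa.
case eac: (e a c) => //; case ead: (e a d) => //; case ebd: (e b d) => //;
  case ebf: (e b f) => //; case ecf: (e c f) => // _ _ _ _.
pose g (i : 'Z_5) := nth a [:: a; b; c; d; f] i.
apply: (@graph_iso_onto _ _ _ _ g).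
- by move=> u v /eqP; rewrite nth_uniq ?ltn_ord // => /eqP/val_inj.
- rewrite card_ord -[5]/(size [:: a; b; c; d; f]) -(card_uniqP us).
  by apply: subset_leq_card; apply/subsetP => y _; apply: allS.
move=> u v; rewrite C5_table /g.
by case: u v => [[|[|[|[|[|u]]]]] Hu] [[|[|[|[|[|v]]]]] Hv] //=;
  rewrite ?simple_e.2 ?eab ?ebc ?ecd ?edf ?efa ?eac ?ead ?ebd ?ebf ?ecf // sym_e
          ?eab ?ebc ?ecd ?edf ?efa ?eac ?ead ?ebd ?ebf ?ecf.
Qed.

End Blocks.

(** * Facet conditions for the listed graphs *)

Section Sufficiency.
Variables (T : finType) (e : rel T).
Hypothesis simple_e : simple_graph e.
Implicit Types (x y z : T) (A D S U : {set T}) (M : {set {set T}}).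

Lemma matching_sides_le M D A : matching e M -> cover M = D ->
  (forall x y, [set x; y] \in M -> (x \in A) != (y \in A)) -> #|D :&: A| <= #|D :\: A|.
Proof.
move=> mM cM sides; have inj_m : injective (mate M) := can_inj (mateK simple_e mM).
rewrite -(card_imset _ inj_m); apply: subset_leq_card; apply/subsetP => _ /imsetP[x + ->].
rewrite inE -cM => /andP[xM xA].
have [y _ xyM] := cover_partner simple_e mM xM; rewrite (mate_in simple_e mM xyM).
have [_ yM] := cover_edge xyM; rewrite inE yM andbT.
by have := sides x y xyM; rewrite xA; case: (y \in A).
Qed.

Lemma matching_sides M D A : matching e M -> cover M = D ->
  (forall x y, [set x; y] \in M -> (x \in A) != (y \in A)) -> #|D :&: A| = #|D :\: A|.
Proof.
move=> mM cM sides; apply/eqP; rewrite eqn_leq (matching_sides_le mM cM sides) /=.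
have sidesC x y : [set x; y] \in M -> (x \in ~: A) != (y \in ~: A).
  by move/sides; rewrite !inE; case: (x \in A); case: (y \in A).
by have := matching_sides_le mM cM sidesC; rewrite -setDE [D :\: ~: A]setDE setCK.
Qed.

(** Deleting any vertex of [S] balances the two sides, so a vertex in [A] makes the side [A] larger
    by one and a vertex outside makes it smaller by one. A matched edge supplies both. *)
Lemma factor_critical_not_bipartite S A : factor_critical e S -> 2 < #|S| ->
  ~ {in S &, forall x y, e x y -> (x \in A) != (y \in A)}.
Proof.
move=> fcS gt2 sides.
have sidesM s M x y : matching e M -> cover M = S :\ s -> [set x; y] \in M ->
    (x \in A) != (y \in A).
  move=> mM cM xyM; have [xM yM] := cover_edge xyM; rewrite cM in xM yM.
  have [[_ xS] [_ yS]] := (setD1P xM, setD1P yM).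
  by apply: sides; rewrite ?(matching_edge simple_e mM).
have bal s : s \in S -> #|(S :\ s) :&: A| = #|(S :\ s) :\: A|.
  move=> sS; have [M mM cM] := fcS s sS.
  by apply: (matching_sides mM cM) => x y; apply: sidesM mM cM.
have [s sS] : exists s, s \in S by apply/card_gt0P; apply: ltn_trans gt2.
have [t] : exists t, t \in S :\ s.
  by apply/card_gt0P; move: gt2; rewrite (cardsD1 s) sS; case: #|_|.
have [M mM cM] := fcS s sS; rewrite -cM => /(cover_partner simple_e mM)[u _ tuM].
have [tM uM] := cover_edge tuM; rewrite cM in tM uM.
have [[_ tS] [_ uS]] := (setD1P tM, setD1P uM).
have dropA x : x \in S -> x \in A -> #|S :&: A| = #|S :\: A|.+1.
  move=> xS xA; rewrite (cardsD1 x) inE xS xA -setIDAC bal //; congr _.+1.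
  by apply: eq_card => z; rewrite !inE; case: eqP => // ->; rewrite xA.
have dropC x : x \in S -> x \notin A -> #|S :\: A| = #|S :&: A|.+1.
  move=> xS xA; rewrite (cardsD1 x) inE xS xA setDDl setUC -setDDl -bal //; congr _.+1.
  by apply: eq_card => z; rewrite !inE; case: eqP => // ->; rewrite (negbTE xA) !andbF.
have := sidesM s M t u mM cM tuM; case tA: (t \in A); case uA: (u \in A) => // _.
  have := dropA t tS tA; have := dropC u uS (negbT uA); lia.
have := dropA u uS uA; have := dropC t tS (negbT tA); lia.
Qed.

Lemma factor_critical3 S : factor_critical e S -> #|S| = 3 ->
  {in S &, forall x y, x != y -> e x y}.
Proof.
move=> fcS S3 x y xS yS nxy.
have [z] : exists z, z \in S :\ x :\ y.
  apply/card_gt0P; have := S3; rewrite (cardsD1 x) xS (cardsD1 y) in_setD1 yS eq_sym nxy.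
  by rewrite !add1n => -[->].
case/setD1P => nzy /setD1P[nzx zS]; have [M mM cM] := fcS z zS.
have /(cover_partner simple_e mM)[u exu xuM] : x \in cover M by rewrite cM !inE eq_sym nzx.
have [_] := cover_edge xuM; rewrite cM => /setD1P[nuz uS].
suff -> : y = u by [].
apply/eqP; apply: contraT => nyu.
have : [set x; y; z; u] \subset S.
  by apply/subsetP => w; rewrite !inE -!orbA => /or4P[]/eqP ->.
move/subset_leq_card; rewrite S3 -!setUA !cardsU1 !inE cards1 !negb_or.
by rewrite nxy (eq_sym x z) nzx (edge_neq simple_e exu) (eq_sym y z) nzy nyu (eq_sym z u) nuz.
Qed.

Lemma factor_critical3_ecount S : factor_critical e S -> #|S| = 3 -> ecount e S = 3.
Proof.
move=> fcS S3; apply: double_inj; rewrite -(handshake simple_e).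
rewrite (eq_bigr (fun=> 2)) ?sum_nat_const ?S3 // => x xS.
have -> : [set y in S | e x y] = S :\ x.
  apply/setP => y; rewrite !inE andbC; case yS: (y \in S); rewrite ?andbF // !andbT.
  have [->|nyx] := eqVneq y x; first by rewrite simple_e.2.
  by apply: (factor_critical3 fcS S3); rewrite // eq_sym.
by have := S3; rewrite (cardsD1 x) xS add1n => -[].
Qed.

Lemma ecount_image (I : finType) (g : I -> T) : injective g ->
  \sum_i \sum_j (e (g i) (g j) : nat) = (ecount e [set g i | i : I]).*2.
Proof.
move=> inj_g; have ug : uniq [seq g i | i <- enum I] by rewrite map_inj_uniq ?enum_uniq.
have -> : [set g i | i : I] = [set x in [seq g i | i <- enum I]].
  apply/setP => x; rewrite inE; apply/imsetP/mapP => -[i _ ->]; exists i => //.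
  by rewrite mem_enum.
rewrite -(ecount_seq simple_e ug) big_map big_enum /=; apply: eq_bigr => i _.
by rewrite big_map big_enum.
Qed.

Lemma C5'_ecount : \sum_(i : 'Z_5) \sum_(j : 'Z_5) (C5' i j : nat) = 14.
Proof.
under eq_bigr do under eq_bigr do rewrite C5'_table.
by rewrite !(big_ord_recl, big_ord0).
Qed.

Lemma C5_degree (i : 'Z_5) : \sum_(j : 'Z_5) (C5 i j : nat) = 2.
Proof.
under eq_bigr do rewrite C5_table.
by rewrite !(big_ord_recl, big_ord0); case: i => [[|[|[|[|[|i]]]]] Hi].
Qed.

(** Only vertex sets need to be maximized, since a nonseparable subgraph stays so when all induced
    edges are added. *)
Lemma block_exists S : nonseparable e S (induced_rel e S) ->
  exists2 U : {set T}, S \subset U & block e U (induced_rel e U).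
Proof.
move=> nsS; pose P (U : {set T}) := `[< nonseparable e U (induced_rel e U) >].
have PS : P S by apply/asboolP.
have [U /maxsetP[/asboolP nsU maxU] SU] := maxset_exists PS.
exists U => //; split=> // U' d' nsd' UU' subd.
have [nsU' subd'] := nonseparable_induced simple_e nsd'.
have eqU : U' = U by apply: maxU => //; apply/asboolP.
split=> // x y; apply/idP/idP => [/subd'|/subd //]; by rewrite eqU.
Qed.

(** Factor-critical sets are odd, and they do not exist in bipartite parts. The cases left are 5 + 1
    = 3 . 2 for the triangle-free C5, and for k = 4 the counts 3 + 1 = 4 . 1 of a triangle and 7 + 1
    = 4 . 2 of [C5']. *)
Lemma sufficiency :
  [\/ bipartite e /\ (forall u v, essential e u -> essential e v -> degree e u = degree e v),
      graph_iso e C5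
    | (forall u, essential e u -> degree e u = 3) /\
      (forall (U : {set T}) (d : rel T), block e U d ->
         let b := subgraph_rel U d in
         bipartite b \/ graph_iso b (complete_graph 3) \/
         graph_iso b (complete_graph 4) \/ graph_iso b K112 \/
         graph_iso b C5')] ->
  exists k, [/\ 0 < k, forall v, essential e v -> (degree e v).+1 = k
    & forall S, factor_critical e S -> 2 < #|S| -> nonseparable e S (induced_rel e S) ->
        (ecount e S).+1 = k * (#|S|)./2].
Proof.
case=> [[[A bipA] eq_deg]|[f bij_f fe]|[deg3 blocks]].
- have nofc S : factor_critical e S -> 2 < #|S| -> nonseparable e S (induced_rel e S) -> False.
    move=> fcS gt2 _; apply: (factor_critical_not_bipartite fcS gt2) => x y _ _; exact: bipA.
  case: (pselect (exists u, essential e u)) => [[u essu]|none].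
    exists (degree e u).+1; split=> // [v essv|S fcS gt2 nsS]; first by rewrite (eq_deg v u).
    by case: (nofc S fcS gt2 nsS).
  (* Without essential vertices both conditions are vacuous, and any positive k serves. *)
  by exists 1; split=> // [v essv|S fcS gt2 /(nofc S fcS gt2)//]; case: none; exists v.
- exists 3; have [g fK gK] := bij_f.
  have inj_g : injective g := can_inj gK.
  have ge i j : e (g i) (g j) = C5 i j by rewrite fe !gK.
  have gT : [set g i | i : 'Z_5] = setT.
    by apply/setP => x; rewrite in_setT; apply/imsetP; exists (f x).
  have T5 : #|T| = 5 by rewrite (bij_eq_card bij_f) card_ord.
  split=> // [v _|S fcS gt2 _].
    rewrite /degree -(fK v) -sum1dep_card big_mkcond /=.
    rewrite (reindex g) /=; last by exists f => x _; [apply: gK | apply: fK].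
    by rewrite (eq_bigr (fun j => C5 (f v) j : nat)) ?C5_degree // => j _; rewrite ge; case: C5.
  have [x xS] : exists x, x \in S by apply/card_gt0P; apply: ltn_trans gt2.
  have oS := factor_critical_odd simple_e fcS xS.
  have leS : #|S| <= 5 by rewrite -T5; apply: max_card.
  have [S3|S5] : #|S| = 3 \/ #|S| = 5.
    by move: oS gt2 leS; case: #|S| => [|[|[|[|[|[|n]]]]]] // _ _ _; [left | right].
    have tri := factor_critical3 fcS S3.
    have /card_gt1P[y [z [yS zS nyz]]] : 1 < #|S :\ x|.
      by have := S3; rewrite (cardsD1 x) xS add1n => -[->].
    have [[nyx {}yS] [nzx {}zS]] := (setD1P yS, setD1P zS).
    have : [/\ e x y, e x z & e y z] by split; apply: tri; rewrite // eq_sym.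
    rewrite !fe !C5_table => -[].
    by case: (f x) (f y) (f z) => [[|[|[|[|[|?]]]]] ?] [[|[|[|[|[|?]]]]] ?] [[|[|[|[|[|?]]]]] ?].
  have ST : S = setT by apply/eqP; rewrite eqEcard subsetT cardsT T5 S5.
  have : (ecount e S).*2 = 10.
    rewrite ST -gT -ecount_image //.
    under eq_bigr do under eq_bigr do rewrite ge.
    by under eq_bigr do rewrite C5_degree; rewrite sum_nat_const card_ord.
  by rewrite S5; case: ecount => [|[|[|[|[|[|n]]]]]].
exists 4; split=> // [v /deg3 ->//|S fcS gt2 nsS].
have [U SU blU] := block_exists nsS.
have [x xS] : exists x, x \in S by apply/card_gt0P; apply: ltn_trans gt2.
have oS := factor_critical_odd simple_e fcS xS.
have small : #|U| <= 4 -> (ecount e S).+1 = 4 * (#|S|)./2.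
  move=> le4; have S3 : #|S| = 3.
    have := leq_trans (subset_leq_card SU) le4.
    by move: oS gt2; case: #|S| => [|[|[|[|[|n]]]]].
  by rewrite S3 (factor_critical3_ecount fcS S3).
have card_iso (T2 : finType) (e2 : rel T2) :
    graph_iso (subgraph_rel U (induced_rel e U)) e2 -> #|U| = #|T2|.
  by case=> h bij_h _; rewrite -(bij_eq_card bij_h) card_sig; apply: eq_card => y; rewrite !inE.
case: (blocks U _ blU) => [[A bipA]|[|[|[]]]].
- case: (@factor_critical_not_bipartite S [set val u | u in A] fcS gt2).
  move=> y z yS zS eyz; have [yU zU] := (subsetP SU y yS, subsetP SU z zS).
  have := bipA (exist _ y yU) (exist _ z zU).
  rewrite /subgraph_rel /induced_rel /= yU zU eyz => /(_ isT).
  have inA u : (val u \in [set val w | w in A]) = (u \in A) by rewrite mem_imset //; apply: val_inj.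
  by rewrite -!inA.
- by move/card_iso; rewrite card_ord => U3; apply: small; rewrite U3.
- by move/card_iso; rewrite card_ord => U4; apply: small; rewrite U4.
- by have [_ [_ c4 _]] := K112_code; move/card_iso; rewrite c4 => U4; apply: small; rewrite U4.
move=> isoC; have U5 := card_iso _ _ isoC; rewrite card_ord in U5.
have [S3|S5] : #|S| = 3 \/ #|S| = 5.
  have := subset_leq_card SU; rewrite U5; move: oS gt2.
  by case: #|S| => [|[|[|[|[|[|n]]]]]] // _ _ _; [left | right].
  by rewrite S3 (factor_critical3_ecount fcS S3).
have eqSU : S = U by apply/eqP; rewrite eqEcard SU U5 S5.
case: isoC => h [g hK gK] he.
have inj_g : injective (val \o g) by apply: inj_comp (can_inj gK); apply: val_inj.
have gS : [set (val \o g) i | i : 'Z_5] = S.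
  apply/setP => y; rewrite eqSU; apply/imsetP/idP => [[i _ ->]|yU]; first exact: valP.
  by exists (h (exist _ y yU)); rewrite //= hK.
have : (ecount e S).*2 = 14.
  rewrite -gS -ecount_image // -C5'_ecount; apply: eq_bigr => i _; apply: eq_bigr => j _.
  by rewrite -[i in RHS]gK -[j in RHS]gK -he /subgraph_rel /induced_rel /= !(valP (g _)).
by rewrite S5; case: ecount => [|[|[|[|[|[|[|[|n]]]]]]]].
Qed.

End Sufficiency.

(** * Facets and reflexivity *)

(* classical_sets shadows the set notations of finset used above. *)
From mathcomp Require Import classical_sets reals.

Section Polytopes.
Local Open Scope ring_scope.
Local Open Scope classical_set_scope.
Variables (R : realType) (I : finType).
Local Notation V := {ffun I -> R^o}.
Local Notation point := (@lattice_point R I).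
Implicit Types (X P : set V) (x y z w : V) (a : {ffun I -> int}).

Lemma dotpC x y : dotp x y = dotp y x.
Proof. by apply: eq_bigr => i _; rewrite mulrC. Qed.

Lemma dotpDl x y z : dotp (x + y) z = dotp x z + dotp y z.
Proof. by rewrite -big_split; apply: eq_bigr => i _; rewrite ffunE mulrDl. Qed.

Lemma dotpZl (c : R) x y : dotp (c *: x) y = c * dotp x y.
Proof. by rewrite mulr_sumr; apply: eq_bigr => i _; rewrite ffunE -mulrA. Qed.

Lemma dotpNl x y : dotp (- x) y = - dotp x y.
Proof. by rewrite -scaleN1r dotpZl mulN1r. Qed.

Lemma dotpNr x y : dotp x (- y) = - dotp x y.
Proof. by rewrite dotpC dotpNl dotpC. Qed.

Lemma dotp0l y : dotp 0 y = 0.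
Proof. by rewrite -(scale0r (0 : V)) dotpZl mul0r. Qed.

Lemma dotp_suml (J : Type) (s : seq J) (p : pred J) (c : J -> R) (v : J -> V) y :
  dotp (\sum_(j <- s | p j) c j *: v j) y = \sum_(j <- s | p j) c j * dotp (v j) y.
Proof.
elim/big_rec2: _ => [|j u z _ <-]; first by rewrite dotp0l.
by rewrite dotpDl dotpZl.
Qed.

Lemma dotp_sumr (J : Type) (s : seq J) (p : pred J) (c : J -> R) (v : J -> V) y :
  dotp y (\sum_(j <- s | p j) c j *: v j) = \sum_(j <- s | p j) c j * dotp y (v j).
Proof. by rewrite dotpC dotp_suml; apply: eq_bigr => j _; rewrite dotpC. Qed.

Lemma conv_hull_fin (J : finType) X (v : J -> V) (c : J -> R) :
  (forall j, X (v j)) -> (forall j, 0 <= c j) -> \sum_j c j = 1 ->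
  conv_hull X (\sum_j c j *: v j).
Proof.
move=> Xv c_ge0 c1; exists #|J|, (v \o enum_val), (c \o enum_val); split=> //.
- by move=> i; apply: Xv.
- by move=> i; apply: c_ge0.
- by rewrite -c1 [RHS](reindex _ (onW_bij _ (enum_val_bij J))).
- by rewrite [LHS](reindex _ (onW_bij _ (enum_val_bij J))).
Qed.

Lemma sub_conv_hull X x : X x -> conv_hull X x.
Proof.
move=> Xx; have := @conv_hull_fin unit X (fun=> x) (fun=> 1).
rewrite !big_const !card_unit /= !addr0 scale1r; apply=> //.
Qed.

Lemma conv_hull_dotp_le X w (b : R) x :
  (forall y, X y -> dotp w y <= b) -> conv_hull X x -> dotp w x <= b.
Proof.
move=> le_b [n [v [c [Xv c_ge0 c1 ->]]]]; rewrite dotp_sumr -[b]mul1r -c1 mulr_suml.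
by apply: ler_sum => i _; rewrite ler_wpM2l // le_b.
Qed.

Lemma conv_hull_image_affine (k : R) (b : V) X :
  [set k *: x - b | x in conv_hull X] = conv_hull [set k *: x - b | x in X].
Proof.
apply/seteqP; split=> [_ [_ [n [v [c [Xv c_ge0 c1 ->]]]] <-]|].
  exists n, (fun i => k *: v i - b), c; split=> // [i|]; first by exists (v i).
  under [RHS]eq_bigr do rewrite scalerBr.
  rewrite sumrB -scaler_suml c1 scale1r scaler_sumr; congr (_ - _).
  by apply: eq_bigr => i _; rewrite !scalerA mulrC.
move=> _ [n [v [c [Xv c_ge0 c1 ->]]]].
pose u i := sval (cid2 (Xv i)).
have Xu i : X (u i) by rewrite /u; case: cid2.
have vE i : v i = k *: u i - b by rewrite /u; case: cid2.
exists (\sum_i c i *: u i); first by exists n, u, c.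
under [RHS]eq_bigr do rewrite vE scalerBr.
rewrite sumrB -scaler_suml c1 scale1r scaler_sumr; congr (_ - _).
by apply: eq_bigr => i _; rewrite !scalerA mulrC.
Qed.

Lemma lattice_polytope_fin (M : finType) (pM : pred M) (x : M -> {ffun I -> int}) :
  lattice_polytope (conv_hull [set point (x m) | m in [set m | pM m]]).
Proof.
exists [seq x m | m <- enum pM]; congr conv_hull; apply/seteqP; split.
  by move=> _ [m /= pm <-]; exists (x m) => //=; apply/map_f; rewrite mem_enum.
by move=> _ [_ /= /mapP[m mM ->] <-]; exists m => //=; rewrite mem_enum in mM.
Qed.

Lemma pointN a : point (- a) = - point a.
Proof. by apply/ffunP => i; rewrite !ffunE mulrNz. Qed.

Lemma point0 : point 0 = 0.
Proof. by apply/ffunP => i; rewrite !ffunE. Qed.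

Section Vertices.
Variables (M : finType) (pM : pred M) (x : M -> {ffun I -> int}).
Let P : set V := conv_hull [set point (x m) | m in [set m | pM m]].

Lemma dilate_lattice_polytope (k : nat) a :
  lattice_polytope [set k%:R *: u - point a | u in P].
Proof.
have -> : [set k%:R *: u - point a | u in P] =
    conv_hull [set point ([ffun i => k%:Z * x m i - a i] : {ffun I -> int}) | m in [set m | pM m]].
  rewrite /P conv_hull_image_affine; congr conv_hull; apply/seteqP; split.
    move=> _ [_ [m pm <-] <-]; exists m => //.
    by apply/ffunP => i; rewrite !ffunE rmorphB rmorphM.
  move=> _ [m pm <-]; exists (point (x m)); first by exists m.
  by apply/ffunP => i; rewrite !ffunE rmorphB rmorphM.
exact: lattice_polytope_fin.
Qed.

Lemma vertex_in m : pM m -> P (point (x m)).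
Proof. by move=> pm; apply: sub_conv_hull; exists m. Qed.

Lemma vertex_le w (b : R) u :
  (forall m, pM m -> dotp w (point (x m)) <= b) -> P u -> dotp w u <= b.
Proof. by move=> le_b; apply: conv_hull_dotp_le => _ [m pm <-]; apply: le_b. Qed.

(** * Linear programming duality and the polar dual *)

Section Sufficiency.
Variables (m0 : M) (pm0 : pM m0).
Variables (J : finType) (good : pred J) (a : J -> {ffun I -> int}) (b : J -> int).

Definition maximizes w m : bool :=
  pM m && [forall m', pM m' ==> (dotp w (point (x m')) <= dotp w (point (x m)))].

Lemma maximizesP w m :
  reflect (pM m /\ forall m', pM m' -> dotp w (point (x m')) <= dotp w (point (x m)))
    (maximizes w m).
Proof.
apply: (iffP andP) => -[pm] => [/forallP|] maxm; split=> //.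
  by move=> m' pm'; have := maxm m'; rewrite pm'.
by apply/forallP => m'; apply/implyP; apply: maxm.
Qed.

Hypothesis valid : forall j m, good j -> pM m ->
  dotp (point (a j)) (point (x m)) <= (b j)%:~R.
Hypothesis proper_face : forall j, good j ->
  exists2 m, pM m & dotp (point (a j)) (point (x m)) < (b j)%:~R.
Hypothesis complete : forall w, w != 0 -> exists2 j, good j &
  forall m, maximizes w m -> dotp (point (a j)) (point (x m)) = (b j)%:~R.

(* Subtract from w the largest multiple of a tight normal that keeps all
   maximizers: at least one new maximizer appears. *)
Lemma lp_duality w : exists c : J -> R,
  [/\ forall j, 0 <= c j, forall j, ~~ good j -> c j = 0,
      w = \sum_j c j *: point (a j)
    & exists2 m, pM m & dotp w (point (x m)) = \sum_j c j * (b j)%:~R].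
Proof.
have [n] := ubnP #|[set m | ~~ maximizes w m]|%SET.
elim: n w => // n IHn w ltn.
have [->|w0] := eqVneq w 0.
  exists (fun=> 0); split=> //; first by rewrite big1 // => j _; rewrite scale0r.
  by exists m0 => //; rewrite dotp0l big1 // => j _; rewrite mul0r.
have [j gj tight] := complete w0.
have [mx pmx maxm] := @arg_maxP _ _ _ m0 pM (fun m => dotp w (point (x m))) pm0.
have maxmx : maximizes w mx by apply/maximizesP.
have [ml pml ltml] := proper_face gj.
pose gap m := (b j)%:~R - dotp (point (a j)) (point (x m)) : R.
pose loss m := dotp w (point (x mx)) - dotp w (point (x m)).
have pl : pM ml && (0 < gap ml) by rewrite pml subr_gt0.
have [m1 /andP[pm1 gap1] minm1] :=
  @arg_minP _ _ _ ml (fun m => pM m && (0 < gap m)) (fun m => loss m / gap m) pl.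
set t := loss m1 / gap m1 in minm1.
have loss_ge0 m : pM m -> 0 <= loss m by move=> pm; rewrite subr_ge0; apply: maxm.
have t_ge0 : 0 <= t by rewrite divr_ge0 ?loss_ge0 // ltW.
pose w' := w - t *: point (a j).
have w'E m : dotp w' (point (x m)) = dotp w (point (x m)) - t * dotp (point (a j)) (point (x m)).
  by rewrite dotpDl dotpNl dotpZl.
have le_w' m : pM m -> dotp w' (point (x m)) <= dotp w (point (x mx)) - t * (b j)%:~R.
  move=> pm; rewrite w'E -subr_ge0.
  suff : t * gap m <= loss m by rewrite /gap /loss; lra.
  have [gap_gt0|] := ltrP 0 (gap m).
    by rewrite -ler_pdivlMr // minm1 // pm.
  by rewrite le_eqVlt ltNge subr_ge0 valid // orbF => /eqP ->; rewrite mulr0 loss_ge0.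
have eq_w' m : maximizes w m -> dotp w' (point (x m)) = dotp w (point (x mx)) - t * (b j)%:~R.
  move=> maxwm; rewrite w'E tight //; congr (_ - _); apply/le_anti.
  by case/maximizesP: maxwm => pm /(_ _ pmx) ->; rewrite andbT; apply: maxm.
have eq_w'1 : dotp w' (point (x m1)) = dotp w (point (x mx)) - t * (b j)%:~R.
  have : t * gap m1 = loss m1 by rewrite /t divfK // gt_eqF.
  by rewrite w'E /gap /loss; lra.
have max' m : pM m -> dotp w' (point (x m)) = dotp w (point (x mx)) - t * (b j)%:~R ->
    maximizes w' m.
  by move=> pm eqm; apply/maximizesP; split=> // m' pm'; rewrite eqm le_w'.
have lt_card : (#|[set m | ~~ maximizes w' m]%SET| < #|[set m | ~~ maximizes w m]%SET|)%N.
  apply: proper_card; apply/properP; split.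
    apply/fintype.subsetP => m; rewrite !finset.inE; apply: contra => maxwm.
    by apply: max' (eq_w' m maxwm); case/maximizesP: maxwm.
  exists m1; rewrite !finset.inE ?negbK ?max' //.
  by apply/negP => /tight eq1; move: gap1; rewrite /gap eq1 subrr ltxx.
have [c [c_ge0 c0 def_w' [m pm wm]]] := IHn w' (leq_trans lt_card ltn).
exists (fun i => c i + t * (i == j)%:R); split.
- by move=> i; rewrite addr_ge0 ?c_ge0 ?(mulr_ge0 t_ge0) ?ler0n.
- move=> i ngi; rewrite c0 // add0r; case: eqP => [ij|]; last by rewrite mulr0.
  by rewrite ij gj in ngi.
- under eq_bigr do rewrite scalerDl.
  rewrite big_split /= -def_w' (bigD1 j) //= eqxx mulr1 big1 ?addr0 ?subrK // => i /negbTE ->.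
  by rewrite mulr0 scale0r.
(* The induction attains the dual value for [w'] at some [m]. Validity bounds [w'] at [mx] by the
   same value, and [mx] still maximizes [w'], so [mx] attains it; there [w] exceeds [w'] by exactly
   t b_j. *)
exists mx => //; under eq_bigr do rewrite mulrDl.
rewrite big_split /= -wm (bigD1 j) //= eqxx mulr1 big1 => [|i /negbTE ->]; last first.
  by rewrite mulr0 mul0r.
have := le_w' m pm; have : dotp w' (point (x mx)) <= dotp w' (point (x m)).
  rewrite wm def_w' dotp_suml; apply: ler_sum => i _.
  have [gi|/c0 ->] := boolP (good i); last by rewrite !mul0r.
  by rewrite ler_wpM2l ?valid.
rewrite (eq_w' mx maxmx); lra.
Qed.

Variable k : nat.
Hypothesis k_gt0 : (0 < k)%N.
Hypothesis height : forall j, good j ->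
  k%:R * (b j)%:~R - \sum_i (a j i)%:~R = 1 :> R.

(** By [height], kP - (1, ..., 1) satisfies a_j.u <= 1 for each good j, so the polar dual should be
    the hull of 0 and the points -a_j. Duality writes -y as a nonnegative combination of the a_j
    whose bound is attained at a vertex of P. *)
Lemma gorenstein_of_facets : gorenstein P.
Proof.
split; first exact: lattice_polytope_fin.
pose one : {ffun I -> int} := [ffun=> 1].
exists k, one; split=> //; split; first exact: dilate_lattice_polytope.
exists (0 :: [seq - a j | j <- enum good]).
have one_dot w : dotp (point one) w = \sum_i w i.
  by apply: eq_bigr => i _; rewrite !ffunE mul1r.
have height_dot j : good j -> k%:R * (b j)%:~R - dotp (point one) (point (a j)) = 1.
  by move=> gj; rewrite one_dot -[RHS](height gj); congr (_ - _); apply: eq_bigr => i _; rewrite ffunE.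
apply/seteqP; split=> [y yQ|y [n [v [c [Xv c_ge0 c1 ->]]]]]; last first.
  move=> _ [u Pu <-]; rewrite dotp_sumr -[- 1]mul1r -[X in X * -1]c1 mulr_suml.
  apply: ler_sum => i _; rewrite ler_wpM2l //; have [e /= es <-] := Xv i.
  move: es; rewrite in_cons => /orP[/eqP ->|/mapP[j gj ->]].
    by rewrite point0 dotpC dotp0l lerN10.
  rewrite mem_enum in gj; rewrite pointN dotpC dotpNl lerN2 dotpC dotpDl dotpNl dotpZl.
  rewrite -[leRHS](height_dot j gj) lerD2r ler_wpM2l // dotpC; apply: vertex_le Pu => m pm.
  exact: valid.
have [c [c_ge0 c0 def_y [m pm ym]]] := lp_duality (- y).
(* At the vertex where the dual bound is attained, [y] takes the value minus the sum of the c_j,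
   which is at least -1. *)
have sum_c : \sum_j c j <= 1.
  have := yQ (k%:R *: point (x m) - point one).
  move=> /(_ (ex_intro2 _ _ _ (vertex_in pm) erefl)).
  rewrite dotpDl dotpNl dotpZl.
  have -> : dotp (point (x m)) y = - \sum_j c j * (b j)%:~R.
    by rewrite -ym dotpNl opprK dotpC.
  have -> : dotp (point one) y = - \sum_j c j * dotp (point one) (point (a j)).
    by rewrite -dotp_sumr -def_y dotpNr opprK.
  suff -> : \sum_j c j = k%:R * (\sum_j c j * (b j)%:~R) -
      \sum_j c j * dotp (point one) (point (a j)) by lra.
  rewrite mulr_sumr -sumrB; apply: eq_bigr => j _.
  have [gj|/c0 ->] := boolP (good j); last by rewrite !mul0r mulr0 subrr.
  by rewrite -[LHS]mulr1 -[X in _ * X = _](height_dot j gj); ring.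
(* [None] stands for the origin, which receives the remaining weight 1 - sum of the c_j. *)
pose v (o : option J) : V := if o is Some j then if good j then - point (a j) else 0 else 0.
pose d (o : option J) : R := if o is Some j then c j else 1 - \sum_j c j.
have -> : y = \sum_o d o *: v o.
  rewrite (bigD1 None) //= scaler0 add0r (reindex_omap Some id) => [|[]] //=.
  rewrite -[LHS]opprK def_y -sumrN; apply: eq_big => [j|j _]; first by rewrite eqxx.
  by have [gj|/c0 ->] := boolP (good j); rewrite ?scalerN // !scale0r oppr0.
apply: conv_hull_fin.
- case=> [j|] /=; last by exists 0; rewrite ?point0 //= in_cons eqxx.
  have [gj|_] := boolP (good j); last by exists 0; rewrite ?point0 //= in_cons eqxx.
  exists (- a j); last exact: pointN.
  by rewrite /= in_cons (map_f (fun j => - a j)) ?orbT // mem_enum.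
- by case=> [j|] /=; rewrite ?c_ge0 // subr_ge0.
rewrite (bigD1 None) //= (reindex_omap Some id) => [|[]] //=.
by rewrite [X in _ + X](eq_bigl predT) ?subrK // => j; rewrite eqxx.
Qed.

End Sufficiency.

(** One pair (k, al) serves all facets. The third premise says that the face is a facet. The polar
    vertex -a / dl is integral and [a] has an entry of absolute value 1, so dl divides 1. *)
Lemma gorenstein_facet : gorenstein P -> exists (k : nat) (al : {ffun I -> int}),
  (0 < k)%N /\ forall a (b : int),
    (forall m, pM m -> dotp (point a) (point (x m)) <= b%:~R) ->
    (exists2 m, pM m & dotp (point a) (point (x m)) = b%:~R) ->
    (forall w (c : R), (forall m, pM m -> dotp (point a) (point (x m)) = b%:~R ->
        dotp w (point (x m)) = c) -> exists l : R, w = l *: point a) ->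
    (exists i, `|a i| = 1) ->
    k%:Z * b - \sum_i a i * al i = 1.
Proof.
case=> _ [k [al [k_gt0 [_ [s defQ]]]]]; exists k, al; split=> // a b valid [mt pmt tmt] facet [i0 ai0].
set dl : int := _ - _.
have dlE : dl%:~R = k%:R * b%:~R - dotp (point a) (point al) :> R.
  rewrite /dl rmorphB rmorphM; congr (_ - _); rewrite rmorph_sum.
  by apply: eq_bigr => i _; rewrite !ffunE rmorphM.
have Pa u : P u -> dotp (point a) u <= b%:~R by apply: vertex_le.
have dotQ u y : dotp (k%:R *: u - point al) y = k%:R * dotp y u - dotp y (point al).
  by rewrite dotpDl dotpNl dotpZl !(dotpC y).
have inQ (t : R) : 0 <= t -> t * dl%:~R <= 1 ->
    polar_dual [set k%:R *: u - point al | u in P] (- t *: point a).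
  move=> t_ge0 t_le1 _ [u Pu <-]; rewrite dotQ !dotpZl.
  have : t * (k%:R * dotp (point a) u) <= t * (k%:R * b%:~R).
    by rewrite !ler_wpM2l // Pa.
  move: t_le1; rewrite dlE; lra.
pose B : R := \sum_(v <- s) `|(v i0)%:~R|.
have bound y : polar_dual [set k%:R *: u - point al | u in P] y -> `|y i0| <= B.
  rewrite defQ => -[n [v [c [Xv c_ge0 c1 ->]]]].
  rewrite sum_ffunE -[B]mul1r -c1 mulr_suml.
  apply: le_trans (ler_norm_sum _ _ _) _; apply: ler_sum => i _.
  rewrite ffunE normrM ger0_norm // ler_wpM2l //.
  have [e /= es <-] := Xv i; rewrite ffunE /B (big_rem e) //= lerDl.
  by apply: sumr_ge0.
have a_i0 : `|point a i0| = 1 by rewrite ffunE -intr_norm ai0.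
(* If dl <= 0, the whole ray of multiples -t a with t >= 0 would lie in the polar dual, whose
   coordinate i0 is bounded by [B]. *)
have dl_gt0 : 0 < dl.
  rewrite ltNge; apply/negP => dl_le0.
  have B_ge0 : 0 <= B by apply: sumr_ge0.
  have := bound _ (@inQ (B + 1) _ _); rewrite ffunE normrM a_i0 mulr1 normrN.
  rewrite ger0_norm ?addr_ge0 // => /(_ isT) le_B.
  have : B + 1 <= B.
    apply: le_B; apply: le_trans ler01; rewrite mulr_ge0_le0 ?addr_ge0 //.
    by rewrite lerz0.
  lra.
have dlR : 0 < dl%:~R :> R by rewrite ltr0z.
have dl0 : dl%:~R != 0 :> R by rewrite gt_eqF.
have y0Q : polar_dual [set k%:R *: u - point al | u in P] (- dl%:~R^-1 *: point a).
  apply: inQ; first by rewrite invr_ge0 ltW.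
  by rewrite mulVf // gt_eqF.
have Qs e : e \in s -> polar_dual [set k%:R *: u - point al | u in P] (point e).
  by move=> es; rewrite defQ; apply: sub_conv_hull; exists e.
move: (y0Q); rewrite {1}defQ => -[n [v [c [Xv c_ge0 c1 def_y0]]]].
have [l cl] : exists l, 0 < c l.
  apply: contrapT => nc; have : \sum_i c i = 0.
    apply: big1 => i _; apply/eqP; rewrite eq_le c_ge0 andbT leNgt.
    by apply/negP => ci; apply: nc; exists i.
  by rewrite c1 => /eqP; rewrite oner_eq0.
have [y /= ys def_y] := Xv l.
(* Over the facet, -a / dl takes the least possible value -1, and every lattice point combined into
   it takes at least -1. So [y], which has a positive coefficient, also takes the value -1 there and
   must be a multiple of [a]. *)
have ytight m : pM m -> dotp (point a) (point (x m)) = b%:~R ->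
    dotp (k%:R *: point (x m) - point al) (point y) = -1.
  move=> pm tm; set z := _ - _.
  have zQ i : -1 <= dotp z (v i).
    by have [e /= es <-] := Xv i; apply: (Qs e es); exists (point (x m)) => //; apply: vertex_in.
  have : dotp z (- dl%:~R^-1 *: point a) = -1.
    rewrite dotQ !dotpZl tm; apply: (mulfI dl0).
    rewrite mulrBr; move: (dlE).
    have : dl%:~R * dl%:~R^-1 = 1 :> R by rewrite mulfV.
    set D := dl%:~R; set D' := D^-1; set p := dotp _ _ => DD' DE.
    have -> : D * (k%:R * (- D' * b%:~R)) = - (D * D') * (k%:R * b%:~R) by ring.
    have -> : D * (- D' * p) = - (D * D') * p by ring.
    by rewrite DD' DE; ring.
  rewrite def_y0 dotp_sumr def_y => sum_z.
  have : \sum_i c i * (dotp z (v i) + 1) = 0.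
    under eq_bigr do rewrite mulrDr mulr1.
    by rewrite big_split /= sum_z c1 addNr.
  have term_ge0 i : true -> 0 <= c i * (dotp z (v i) + 1).
    by move=> _; apply: mulr_ge0 => //; rewrite -lerBlDr sub0r.
  move/(psumr_eq0P term_ge0)/(_ l isT)/eqP.
  by rewrite mulf_eq0 gt_eqF //= addr_eq0 => /eqP.
have k0 : k%:R != 0 :> R by rewrite pnatr_eq0 -lt0n.
have [m pm tm|lam ylam] := facet (point y) ((dotp (point y) (point al) - 1) / k%:R).
  by have := ytight m pm tm; rewrite dotQ => /eqP; rewrite subr_eq addrC => /eqP <-; rewrite mulrC mulKf.
(* Since a_i0 is 1 or -1, the factor of [y] over [a] is an integer. *)
have lamE : lam = (a i0 * y i0)%:~R.
  have yE : (y i0)%:~R = lam * (a i0)%:~R :> R.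
    by have /ffunP/(_ i0) := ylam; rewrite !ffunE.
  rewrite rmorphM /= yE mulrCA -rmorphM /=.
  have -> : a i0 * a i0 = 1 by rewrite -expr2 -real_normK ?num_real // ai0 expr1n.
  by rewrite mulr1.
have : lam * dl%:~R = -1.
  have := ytight mt pmt tmt; rewrite dotQ ylam !dotpZl tmt dlE => <-; ring.
rewrite lamE -rmorphM => /eqP.
rewrite -[-1]/((-1)%:~R) eqr_int => /eqP eq1.
have : (dl %| 1)%Z by apply/dvdzP; exists (- (a i0 * y i0)); rewrite mulNr eq1.
by move: dl_gt0; case: (dl) => [[|[|d]]|d].
Qed.

End Vertices.
End Polytopes.

(** * The matching polytope *)

Section MatchingPolytope.
Local Open Scope ring_scope.
Variables (R : realType) (T : finType) (e : rel T).
Hypothesis simple_e : simple_graph e.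
Local Notation E := (edge e).
Local Notation V := {ffun E -> R^o}.
Local Notation point := (@lattice_point R E).

Definition matching_point (m : {set {set T}}) : {ffun E -> int} :=
  [ffun f => (val f \in m)%:Z].

Lemma matching_polytopeE : matching_polytope R e =
  conv_hull [set point (matching_point m) | m in [set m | matching e m]%classic]%classic.
Proof.
congr conv_hull; apply/seteqP; split=> _ [m mm <-]; exists m => //; apply/ffunP => f;
  by rewrite !ffunE.
Qed.

Lemma sum_edges (A : nmodType) (F : {set T} -> A) :
  \sum_(f : E) F (val f) = \sum_(f in edge_set e) F f.
Proof.
rewrite [RHS](reindex_omap (val : E -> {set T}) insub) => [|f fE]; last by rewrite insubT.
by apply: eq_bigl => f; rewrite valK eqxx (valP f).
Qed.

Lemma dotp_matching (w : V) (W : {set T} -> R) m :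
  (forall f, w f = W (val f)) -> matching e m ->
  dotp w (point (matching_point m)) = \sum_(f in m) W f.
Proof.
move=> wE /andP[/fintype.subsetP sub _].
transitivity (\sum_(f : E) W (val f) * (val f \in m)%:R).
  by apply: eq_bigr => f _; rewrite wE !ffunE.
rewrite (sum_edges (fun f => W f * (f \in m)%:R)) [RHS]big_mkcond [LHS]big_mkcond /=.
apply: eq_bigr => f _; case fm: (f \in m); first by rewrite sub // mulr1.
by rewrite mulr0 if_same.
Qed.

(** Points live on the type of edges while matchings are sets of vertex sets; the weight is extended
    by 0 to non-edges. *)
Definition edge_weight (w : V) (f : {set T}) : R :=
  if insub f is Some g then w g else 0.

Lemma edge_weightE (w : V) (f : E) : w f = edge_weight w (val f).
Proof. by rewrite /edge_weight valK. Qed.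

Definition edge_normal (f0 : E) : {ffun E -> int} := [ffun f => - (f == f0)%:Z].
Definition pred_normal (p : pred {set T}) : {ffun E -> int} := [ffun f => (p (val f))%:Z].

Lemma dotp_edge_normal f0 m : matching e m ->
  dotp (point (edge_normal f0)) (point (matching_point m)) = - (val f0 \in m)%:R.
Proof.
move=> mm; rewrite (@dotp_matching _ (fun f => - (f == val f0)%:R)) // => [|f]; last first.
  by rewrite !ffunE mulrNz (inj_eq val_inj).
rewrite sumrN; congr (- _); rewrite (sum_indicator R m (pred1 (val f0))).
have [f0m|f0m] := boolP (val f0 \in m).
  rewrite (_ : select m _ = [set val f0]%SET) ?cards1 //; apply/setP => f.
  by rewrite in_select finset.in_set1; apply/andP/eqP => [[_ /eqP]//|->]; rewrite /= eqxx.
rewrite (_ : select m _ = finset.set0) ?cards0 //; apply/setP => f.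
by rewrite in_select finset.in_set0; apply/negP => /andP[fm /eqP ff0]; rewrite -ff0 fm in f0m.
Qed.

Lemma dotp_pred_normal p m : matching e m ->
  dotp (point (pred_normal p)) (point (matching_point m)) = #|select m p|%:R.
Proof.
move=> mm; rewrite (@dotp_matching _ (fun f => (p f)%:R)) ?sum_indicator // => f.
by rewrite !ffunE.
Qed.

Lemma sum_edge_normal f0 : \sum_f (edge_normal f0 f)%:~R = -1 :> R.
Proof.
rewrite (bigD1 f0) //= big1 => [|f /negbTE ff0]; rewrite ffunE ?eqxx ?addr0 ?ff0 //.
Qed.

Lemma sum_pred_normal p :
  \sum_f (pred_normal p f)%:~R = #|select (edge_set e) p|%:R :> R.
Proof.
rewrite -sum_indicator -(sum_edges (fun f => (p f)%:R)); apply: eq_bigr => f _.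
by rewrite ffunE.
Qed.

Lemma gorenstein_sufficient k : (0 < k)%N ->
  (forall v, essential e v -> (degree e v).+1 = k) ->
  (forall S, factor_critical e S -> (2 < #|S|)%N -> nonseparable e S (induced_rel e S) ->
     (ecount e S).+1 = (k * (#|S|)./2)%N) ->
  gorenstein (matching_polytope R e).
Proof.
move=> k_gt0 ess odd_sets; rewrite matching_polytopeE.
pose J := (E + (T + {set T}))%type.
pose good (j : J) : bool := match j with
  | inl _ => true
  | inr (inl v) => `[< essential e v >]
  | inr (inr X) => `[< [/\ factor_critical e X, (2 < #|X|)%N & nonseparable e X (induced_rel e X)] >]
  end.
pose a (j : J) : {ffun E -> int} := match j with
  | inl f => edge_normal f
  | inr (inl v) => pred_normal (fun f => v \in f)
  | inr (inr X) => pred_normal (fun f => f \subset X)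
  end.
pose b (j : J) : int := match j with
  | inl _ => 0 | inr (inl _) => 1 | inr (inr X) => (#|X|)./2%:Z
  end.
have oddS S : factor_critical e S -> (2 < #|S|)%N -> odd #|S|.
  move=> fcS gt2; have /card_gt0P[x xS] : (0 < #|S|)%N by apply: leq_trans gt2.
  exact: (factor_critical_odd simple_e fcS xS).
apply: (@gorenstein_of_facets _ _ _ _ _ finset.set0 (matching0 e) J good a b _ _ _ k) => //.
- case=> [f|[v|S]] m /= gj mm; rewrite ?dotp_edge_normal ?dotp_pred_normal //.
  + by rewrite oppr_le0.
  + by rewrite lern1 (matching_degree_le _ mm).
  + by case/asboolP: gj => fcS gt2 _; rewrite ler_nat (matching_select_le simple_e _ mm) ?oddS.
- case=> [f|[v|S]] gj.
  + exists [set val f]%SET; first by apply: matching_set1 => //; apply: valP.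
    by rewrite dotp_edge_normal ?finset.inE ?eqxx ?ltrN10 //; apply: matching_set1 => //; apply: valP.
  + exists finset.set0; first exact: matching0.
    by rewrite dotp_pred_normal ?matching0 // select0 cards0.
  + exists finset.set0; first exact: matching0.
    rewrite dotp_pred_normal ?matching0 // select0 cards0 ltr_nat.
    by case/asboolP: gj => _; case: #|S| => [|[|n]].
- move=> w w_neq0.
  have W_neq0 : exists2 f, f \in edge_set e & edge_weight w f != 0.
    apply: contrapT => none; case/eqP: w_neq0; apply/ffunP => f; rewrite ffunE edge_weightE.
    by apply/eqP; apply: contraT => Wf; case: none; exists (val f) => //; apply: valP.
  have maxE m : maximizes (matching e) matching_point w m -> max_weight e (edge_weight w) m.
    case/maximizesP => mm maxm; split=> // m' mm'.
    by rewrite /weight -!(dotp_matching (edge_weightE w)) // maxm.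
  have mE m : maximizes (matching e) matching_point w m -> matching e m by case/maximizesP.
  case: (tight_constraint simple_e W_neq0) => [[f fE fmax]|[v essv vmax]|[S [fcS gt2 nsS Smax]]].
  + exists (inl (exist _ f fE)) => // m maxm.
    by rewrite dotp_edge_normal ?(mE m) //= (negbTE (fmax m (maxE m maxm))) oppr0.
  + exists (inr (inl v)) => [|m maxm]; first exact/asboolP.
    rewrite dotp_pred_normal ?(mE m) //=.
    by have := vmax m (maxE m maxm); rewrite -(matching_degree1 _ (mE m maxm)) => /eqP ->.
  + exists (inr (inr S)) => [|m maxm]; first by apply/asboolP.
    rewrite dotp_pred_normal ?(mE m) //=.
    by have := Smax m (maxE m maxm); rewrite near_perfect_half ?oddS // => <-.
- case=> [f|[v|S]] /= gj; rewrite ?sum_edge_normal ?sum_pred_normal.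
  + by rewrite mulr0 add0r opprK.
  + rewrite /select degree_edges // mulr1 -(ess v); last exact/asboolP.
    by rewrite -natr1 addrAC subrr add0r.
  + case/asboolP: gj => fcS gt2 nsS; have := odd_sets S fcS gt2 nsS.
    by move=> eqk; rewrite -natrM -eqk -natr1 addrAC subrr add0r.
Qed.

Lemma gorenstein_necessary : gorenstein (matching_polytope R e) ->
  exists k, (forall v, essential e v -> (degree e v).+1 = k) /\
    (forall s, odd_cycle e s -> (ecount e [set x in s]%SET).+1 = (k * (size s)./2)%N).
Proof.
rewrite matching_polytopeE => /gorenstein_facet[k [al [k_gt0 facet]]]; exists k.
have delta_E (f0 : E) : matching e [set val f0]%SET.
  exact: (matching_set1 simple_e (valP f0)).
have m0 := matching0 e.
(* For the facet x_f0 >= 0, written with outer normal -e_f0 and bound 0, the quantity forced to be 1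
   is [al f0]. *)
have al1 f0 : al f0 = 1.
  have := facet (edge_normal f0) 0; rewrite mulr0 sub0r (bigD1 f0) //= big1 => [|f /negbTE ff0]; last first.
    by rewrite ffunE ff0 oppr0 mul0r.
  rewrite addr0 ffunE eqxx mulN1r opprK; apply.
  - by move=> m mm; rewrite dotp_edge_normal // oppr_le0.
  - by exists finset.set0 => //; rewrite dotp_edge_normal // finset.inE oppr0.
  - move=> w c const; exists (- w f0).
    (* The empty matching lies on this facet, so the constant is 0; single edges other than [f0]
       then have weight 0. *)
    have c0 : c = 0.
      rewrite -(const finset.set0) //; last by rewrite dotp_edge_normal // finset.inE oppr0.
      by rewrite (dotp_matching (edge_weightE w)) // big_set0.
    apply/ffunP => f; rewrite !ffunE mulrNz.
    have [->|nff0] := eqVneq f f0; first by rewrite /GRing.scale /= mulrNN mulr1.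
    rewrite /GRing.scale /= oppr0 mulr0 edge_weightE.
    have := const [set val f]%SET (delta_E f).
    rewrite dotp_edge_normal // finset.inE (inj_eq val_inj) eq_sym (negbTE nff0) oppr0.
    by rewrite (dotp_matching (edge_weightE w)) // big_set1 c0; apply.
  - by exists f0; rewrite ffunE eqxx normrN.
(* For a 0/1 normal and [al] constantly 1, the condition becomes a count of the edges selected by
   [p]; stars and odd sets are both of this kind. *)
have facet_pred (p : pred {set T}) (n : nat) :
    (forall m, matching e m -> (#|select m p| <= n)%N) ->
    (exists2 m, matching e m & #|select m p| = n) ->
    (forall (W : {set T} -> R) c,
       (forall m, matching e m -> #|select m p| = n -> \sum_(f in m) W f = c) ->
       exists l, forall f, f \in edge_set e -> W f = if p f then l else 0) ->
    (exists2 f, f \in edge_set e & p f) ->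
    (#|select (edge_set e) p|.+1 = k * n)%N.
  move=> valid [mt mmt tight] const [f1 f1E pf1].
  have := facet (pred_normal p) n%:Z.
  have -> : \sum_i pred_normal p i * al i = #|select (edge_set e) p|%:Z.
    apply/eqP; rewrite -(eqr_int R) -pmulrn -sum_pred_normal rmorph_sum; apply/eqP.
    by apply: eq_bigr => f _; rewrite al1 mulr1.
  move=> eqk; have : k%:Z * n%:Z - #|select (edge_set e) p|%:Z = 1; last by lia.
  apply: eqk.
  - by move=> m mm; rewrite dotp_pred_normal // ler_nat valid.
  - by exists mt => //; rewrite dotp_pred_normal // tight.
  - move=> w c wconst; have [|l Wl] := const (edge_weight w) c.
      move=> m mm tm; rewrite -(dotp_matching (edge_weightE w)) //; apply: wconst => //.
      by rewrite dotp_pred_normal // tm.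
    exists l; apply/ffunP => f; rewrite edge_weightE Wl ?(valP f) // !ffunE /GRing.scale /=.
    by case: (p (val f)); rewrite ?mulr1 ?mulr0.
  - by exists (exist _ f1 f1E); rewrite ffunE /= pf1.
split=> [v essv|s os].
  have [u evu] := essential_neighbor essv.
  have vuE : [set v; u]%SET \in edge_set e by rewrite mem_edge_set.
  rewrite -(degree_edges simple_e) -[RHS]muln1; apply: (facet_pred (fun f => v \in f)).
  - by move=> m mm; apply: matching_degree_le mm.
  - exists [set [set v; u]]%SET; first exact: matching_set1.
    by apply/eqP; rewrite (matching_degree1 _ (matching_set1 simple_e vuE)) cover_set1 set21.
  - move=> W c const; exists c; apply: (essential_const simple_e essv) => m mm vm.
    by apply: const => //; apply/eqP; rewrite (matching_degree1 _ mm).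
  - by exists [set v; u]%SET; rewrite ?set21.
set S := [set x in s]%SET.
have cS : #|S| = size s := odd_cycle_set os erefl.
have oS : odd #|S| by rewrite cS; case/and3P: os.
rewrite -cS; apply: (facet_pred (fun f => f \subset S)).
- by move=> m mm; apply: (matching_select_le simple_e oS mm).
- have [m mm npm] := odd_cycle_near_perfect simple_e os.
  by exists m => //; apply/near_perfect_half.
- move=> W c const; exists (first_edge W s); apply: (odd_cycle_const simple_e _ os erefl) => m mm npm.
  by apply: const mm _; apply/near_perfect_half.
have gt2 := odd_cycle_size simple_e os; rewrite /S.
case: s os gt2 {S cS oS} => [|x [|y s]] //= /and3P[/= /andP[exy _] _ _] _.
exists [set x; y]%SET; first by rewrite mem_edge_set.
by rewrite finset.subUset !finset.sub1set !finset.inE !eqxx orbT.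
Qed.

End MatchingPolytope.

Theorem theorem3p3 (R : realType) (T : finType) (e : rel T)
    (simple_e : simple_graph e) (connected_e : connected_graph e) :
  gorenstein (matching_polytope R e) <->
  [\/ bipartite e /\
        (forall u v : T, essential e u -> essential e v ->
           degree e u = degree e v),
      graph_iso e C5
    | (forall u : T, essential e u -> degree e u = 3%N) /\
      (forall (U : {set T}) (d : rel T), block e U d ->
         let b := subgraph_rel U d in
         bipartite b \/ graph_iso b (complete_graph 3) \/
         graph_iso b (complete_graph 4) \/ graph_iso b K112 \/
         graph_iso b C5')].
Proof.
split=> [/(gorenstein_necessary simple_e)[k [ess odd_cycles]]|classification].
  exact: (necessity simple_e connected_e ess odd_cycles).
have [k [k_gt0 ess odd_sets]] := sufficiency simple_e classification.
exact: (gorenstein_sufficient R simple_e k_gt0 ess odd_sets).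
Qed.
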